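(* Let $\mathfrak g=(\mathfrak g_0\oplus\mathfrak g_{-1},d,[\cdot,\cdot])$ be a strict Lie $2$-algebra, and let $\mathbb G=(G_1,G_0,d^{\mathbb G},\triangleright)$ be the corresponding crossed module of Lie groups (integrating $\mathfrak g$). Then the map from $\mathrm{Aut}(\mathbb G)$ to $\mathrm{SAut}(\mathfrak g)$ given by $$(F,\chi)\longmapsto(F_*,\chi_* ),\qquad F\in\mathrm{Aut}^0(\mathbb G),\ \chi\in\mathrm{Aut}^{-1}(\mathbb G),$$ where $F_*=(F_{0*},F_{1*})$ and $\chi_*$ denote the tangent maps at the identity, is a homomorphism between crossed modules of Lie groups.
   Context: All vector spaces are real and finite-dimensional. A strict Lie $2$-algebra consists of vector spaces $\mathfrak g_0,\mathfrak g_{-1}$, a linear map $d:\mathfrak g_{-1}\to\mathfrak g_0$ and a skew-symmetric bilinear bracket with $[x,y]\in\mathfrak g_0$, $[x,a]=-[a,x]\in\mathfrak g_{-1}$, $[a,b]=0$ ($x,y\in\mathfrak g_0$, $a,b\in\mathfrak g_{-1}$), such that $d[x,a]=[x,da]$, $[da,b]=[a,db]$, and the Jacobi identities $[[x,y],z]+[[y,z],x]+[[z,x],y]=0$, $[[x,y],a]+[[y,a],x]+[[a,x],y]=0$ hold. It corresponds to the crossed module of Lie algebras with $\mathfrak h_0=\mathfrak g_0$, $\mathfrak h_1=\mathfrak g_{-1}$ with bracket $[a,b]_{\mathfrak h_1}=[da,b]$, homomorphism $d$, action $\phi_x(a)=[x,a]$; that $\mathbb G$ corresponds to $\mathfrak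 g$ means that the differentiation of $\mathbb G$ is this crossed module of Lie algebras. A crossed module of Lie groups $(H_1,H_0,\partial,\triangleright)$ consists of Lie groups $H_1,H_0$, a Lie group homomorphism $\partial:H_1\to H_0$ and an action $\triangleright$ of $H_0$ on $H_1$ by automorphisms with $\partial(g\triangleright h)=g\partial(h)g^{-1}$ and $\partial(h)\triangleright h'=hh'h^{-1}$. A homomorphism of crossed modules of Lie groups $(H_1,H_0,\partial,\triangleright)\to(H_1',H_0',\partial',\triangleright')$ is a pair of Lie group homomorphisms $f_1:H_1\to H_1'$, $f_0:H_0\to H_0'$ with $\partial'f_1=f_0\partial$ and $f_1(g\triangleright h)=f_0(g)\triangleright'f_1(h)$. $\mathrm{Aut}(\mathbb G)$ (Norrie). Let $\mathrm{Der}(G_0,G_1)$ be the set of (smooth) maps $\chi:G_0\to G_1$ with $\chi(\alpha\beta)=\chi(\alpha)(\alpha\triangleright\chi(\beta))$, a monoid under $(\chi\ast\chi')(\alpha)=\chi(d^{\mathbb G}(\chi'(\alpha))\alpha)\,\chi'(\alpha)$; $\mathrm{Aut}^{-1}(\mathbb G)$ is its group of units. $\mathrm{Aut}^0(\mathbb G)$ is the group of pairs $(F_0,F_1)\in\mathrm{Aut}(G_0)\times\mathrm{Aut}(G_1)$ with $F_0\circ d^{\mathbb G}=d^{\mathbb G}\circ F_1$ and $F_1(\alpha\triangleright\xi)=F_0(\alpha)\triangleright F_1(\xi)$. The homomorphism $\tilde\partial:\mathrm{Aut}^{-1}(\mathbb G)\to\mathrm{Aut}^0(\mathbb G)$ is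 $\tilde\partial(\chi)(\alpha)=d^{\mathbb G}(\chi(\alpha))\alpha$ for $\alpha\in G_0$, $\tilde\partial(\chi)(\xi)=\chi(d^{\mathbb G}(\xi))\xi$ for $\xi\in G_1$, and the action is $(F_0,F_1)\triangleright\chi=F_1\circ\chi\circ F_0^{-1}$. $\mathrm{Aut}(\mathbb G)=(\mathrm{Aut}^{-1}(\mathbb G),\mathrm{Aut}^0(\mathbb G),\tilde\partial,\triangleright)$ is regarded as a crossed module of Lie groups with its natural smooth structure (in particular the evaluation maps are smooth). $\mathrm{SAut}(\mathfrak g)$. $\mathrm{SAut}^0(\mathfrak g)$ is the Lie group (under composition) of pairs $A=(A_0,A_1)\in GL(\mathfrak g_0)\times GL(\mathfrak g_{-1})$ with $A_0\circ d=d\circ A_1$, $A_0[x,y]=[A_0x,A_0y]$, $A_1[x,a]=[A_0x,A_1a]$. $\mathrm{SAut}^{-1}(\mathfrak g)$ is the set of $\tau\in\mathrm{Hom}(\mathfrak g_0,\mathfrak g_{-1})$ that are invertible for $\tau\star\tau'=\tau+\tau'+\tau\circ d\circ\tau'$ (identity $0$) and satisfy $\tau[x,y]=[x,\tau y]+[\tau x,y]+[\tau x,d\tau y]$ for all $x,y\in\mathfrak g_0$; it is a Lie group under $\star$. The crossed module structure is $\partial(\tau)=(I+d\circ\tau,I+\tau\circ d)$, $A\triangleright\tau=A_1\circ\tau\circ A_0^{-1}$. *)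

(* Defs.v *)
From HB Require Import structures.
From mathcomp Require Import all_boot all_order all_algebra.
From mathcomp Require Import sesquilinear.
From mathcomp Require Import all_classical all_reals all_analysis.
Import numFieldNormedType.Exports.

Set Implicit Arguments.
Unset Strict Implicit.
Unset Printing Implicit Defensive.

Local Open Scope classical_set_scope.
Local Open Scope ring_scope.

(* [f] is C^k at the points of the open set [U]: it is differentiable there and
   all its directional derivatives are C^(k-1). *)
Fixpoint Cn_on (R : realType) (m n k : nat) (U : set 'rV[R]_m)
    (f : 'rV[R]_m -> 'rV[R]_n) : Prop :=
  match k with
  | 0 => forall x, U x -> {for x, continuous f}
  | k'.+1 => (forall x, U x -> differentiable f x) /\
             (forall v, Cn_on k' U (fun x => 'd f x v))
  end.

Definition smooth_on (R : realType) (m n : nat) (U : set 'rV[R]_m)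
    (f : 'rV[R]_m -> 'rV[R]_n) : Prop :=
  forall k, Cn_on k U f.

(* A chart is given by its domain, the coordinate map and the parametrization
   inverse to it; the two maps are only meaningful on [cdom] and on [cimg]. *)
Record chart (R : realType) (M : topologicalType) (n : nat) := Chart {
  cdom : set M;
  cmap : M -> 'rV[R]_n;
  cinv : 'rV[R]_n -> M }.

Definition cimg (R : realType) (M : topologicalType) (n : nat)
    (c : chart R M n) : set 'rV[R]_n :=
  cmap c @` cdom c.

Definition is_chart (R : realType) (M : topologicalType) (n : nat)
    (c : chart R M n) : Prop :=
  [/\ open (cdom c), open (cimg c), {in cdom c, cancel (cmap c) (cinv c)},
      {within cdom c, continuous (cmap c)}
    & {within cimg c, continuous (cinv c)}].

(* [chart_at p] is a preferred chart around [p]: it serves to represent the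
   tangent space at [p] by the model space. *)
HB.mixin Record isCharted (R : realType) (M : Type) of Topological M := {
  mdim : nat;
  atlas : set (chart R M mdim);
  chart_at : M -> chart R M mdim }.

#[short(type="chartedType")]
HB.structure Definition Charted (R : realType) :=
  { M of isCharted R M & Topological M }.

Arguments mdim {R} s.
Arguments atlas {R} s.
Arguments chart_at {R s} _.

HB.mixin Record Charted_isManifold (R : realType) (M : Type)
    of Charted R M := {
  manifold_hausdorff : hausdorff_space M;
  manifold_second_countable : @second_countable M;
  manifold_is_chart : forall c, atlas M c -> is_chart c;
  manifold_compatible : forall c c', atlas M c -> atlas M c' ->
    smooth_on (cmap c @` (cdom c `&` cdom c')) (cmap c' \o cinv c);
  manifold_chart_at : forall p : M, atlas M (chart_at p);
  manifold_chart_at_dom : forall p : M, cdom (chart_at p) p }.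

#[short(type="manifoldType")]
HB.structure Definition Manifold (R : realType) :=
  { M of Charted_isManifold R M & Charted R M }.

HB.instance Definition _ (R : realType) (n : nat) :=
  isCharted.Build R 'rV[R]_n
    [set Chart setT id id] (fun=> Chart setT id id).

Definition chart_prod (R : realType) (M N : topologicalType) (m n : nat)
    (c : chart R M m) (c' : chart R N n) : chart R (M * N)%type (m + n) :=
  Chart (cdom c `*` cdom c')
        (fun p => row_mx (cmap c p.1) (cmap c' p.2))
        (fun x => (cinv c (lsubmx x), cinv c' (rsubmx x))).

HB.instance Definition _ (R : realType) (M N : chartedType R) :=
  isCharted.Build R (M * N)%type
    [set c | exists c1 c2,
       [/\ atlas M c1, atlas N c2 & c = chart_prod c1 c2]]
    (fun p => chart_prod (chart_at p.1) (chart_at p.2)).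

Definition smooth (R : realType) (M N : chartedType R) (f : M -> N) : Prop :=
  continuous f /\
  forall c c', atlas M c -> atlas N c' ->
    smooth_on (cmap c @` (cdom c `&` f @^-1` cdom c'))
      (cmap c' \o f \o cinv c).

(* The tangent map [T_p M -> T_(f p) N], both tangent spaces being identified
   with the model spaces through the preferred charts. *)
Definition tangent (R : realType) (M N : chartedType R) (f : M -> N) (p : M) :
    'rV[R]_(mdim M) -> 'rV[R]_(mdim N) :=
  'd (cmap (chart_at (f p)) \o f \o cinv (chart_at p)) (cmap (chart_at p) p).

Definition smooth_embedding (R : realType) (M N : chartedType R)
    (f : M -> N) : Prop :=
  [/\ smooth f, forall p, injective (tangent f p), injective f
    & forall U : set M, open U -> exists2 V : set N, open V & U = f @^-1` V].

HB.mixin Record isLieGroup (R : realType) (G : Type)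
    of Group G & Manifold R G := {
  lie_mul_smooth : smooth (fun p : G * G => (p.1 * p.2)%g);
  lie_inv_smooth : smooth (fun x : G => (x^-1)%g) }.

#[short(type="lieGroupType")]
HB.structure Definition LieGroup (R : realType) :=
  { G of isLieGroup R G & Group G & Manifold R G }.

Definition is_lie_hom (R : realType) (G H : lieGroupType R)
    (f : G -> H) : Prop :=
  smooth f /\ {morph f : x y / (x * y)%g}.

Definition is_lie_aut (R : realType) (G : lieGroupType R)
    (f : G -> G) : Prop :=
  is_lie_hom f /\ exists f', [/\ cancel f f', cancel f' f & smooth f'].

Notation lie G := 'rV[_]_(mdim G).

Definition Ad (R : realType) (G : lieGroupType R) (g : G)
    (v : lie G) : lie G :=
  tangent (fun h : G => (g * h * g^-1)%g) 1%g v.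

(* [u, v] = ad_u v, where ad is the derivative of Ad at the identity; this is
   the bracket of the left-invariant vector fields through u and v. *)
Definition lie_bracket (R : realType) (G : lieGroupType R)
    (u v : lie G) : lie G :=
  tangent (fun g : G => Ad g v) 1%g u.

Record lieXMod (R : realType) := LieXMod {
  xm1 : lieGroupType R;
  xm0 : lieGroupType R;
  xmd : xm1 -> xm0;
  xmact : xm0 -> xm1 -> xm1;
  xmd_hom : is_lie_hom xmd;
  xmact_smooth : smooth (fun p : xm0 * xm1 => xmact p.1 p.2);
  xmact_1 : forall h, xmact 1%g h = h;
  xmact_mul : forall g g' h, xmact (g * g')%g h = xmact g (xmact g' h);
  xmact_hom : forall g, {morph xmact g : h h' / (h * h')%g};
  xmd_act : forall g h, xmd (xmact g h) = (g * xmd h * g^-1)%g;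
  xm_peiffer : forall h h', xmact (xmd h) h' = (h * h' * h^-1)%g }.

Record is_lieXMod_hom (R : realType) (X Y : lieXMod R)
    (f1 : xm1 X -> xm1 Y) (f0 : xm0 X -> xm0 Y) : Prop := {
  xmhom1 : is_lie_hom f1;
  xmhom0 : is_lie_hom f0;
  xmhom_d : forall h, xmd (f1 h) = f0 (xmd h);
  xmhom_act : forall g h, f1 (xmact g h) = xmact (f0 g) (f1 h) }.

(* [lbr x y] is the bracket of two elements of degree 0, [lact x a] is the
   bracket [x, a] with a in degree -1; [a, x] is - [x, a], see [ract]. *)
Record strictLie2Alg (R : realType) := StrictLie2Alg {
  lg0 : vectType R;
  lg1 : vectType R;
  ld : 'Hom(lg1, lg0);
  lbr : {bilinear lg0 -> lg0 -> lg0};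
  lact : {bilinear lg0 -> lg1 -> lg1};
  ract := (fun a x => - lact x a) : lg1 -> lg0 -> lg1;
  lbr_skew : forall x y, lbr x y = - lbr y x;
  ld_act : forall x a, ld (lact x a) = lbr x (ld a);
  ld_peiffer : forall a b, lact (ld a) b = ract a (ld b);
  lbr_jacobi : forall x y z,
    lbr (lbr x y) z + lbr (lbr y z) x + lbr (lbr z x) y = 0;
  lact_jacobi : forall x y a,
    lact (lbr x y) a + ract (lact y a) x + ract (ract a x) y = 0 }.

Arguments lbr {R s}.
Arguments lact {R s}.
Arguments ract {R s} _ _.

(* The differentiation of the crossed module [G] is the crossed module of Lie
   algebras of [g], via linear isomorphisms from the Lie algebras of G_0 and
   G_1 onto g_0 and g_{-1}. *)
Record differentiates_to (R : realType) (G : lieXMod R) (g : strictLie2Alg R)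
    (t0 : 'Hom(lie (xm0 G), lg0 g))
    (t1 : 'Hom(lie (xm1 G), lg1 g)) : Prop := {
  diff_iso0 : bijective t0;
  diff_iso1 : bijective t1;
  diff_br0 : forall x y, t0 (lie_bracket x y) = lbr (t0 x) (t0 y);
  diff_br1 : forall a b, t1 (lie_bracket a b) = lact (ld g (t1 a)) (t1 b);
  diff_d : forall a, t0 (tangent (@xmd _ G) 1%g a) = ld g (t1 a);
  diff_act : forall x a,
    t1 (tangent (fun k : xm0 G => tangent (xmact k) 1%g a) 1%g x) =
    lact (t0 x) (t1 a) }.

Section Aut.
Variables (R : realType) (G : lieXMod R).
Implicit Types chi : xm0 G -> xm1 G.

Definition is_derivation chi : Prop :=
  smooth chi /\
  forall a b, chi (a * b)%g = (chi a * xmact a (chi b))%g.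

Definition der_mul chi chi' : xm0 G -> xm1 G :=
  fun a => (chi (xmd (chi' a) * a) * chi' a)%g.

Definition der_one : xm0 G -> xm1 G := fun=> 1%g.

Definition Aut1 : set (xm0 G -> xm1 G) :=
  [set chi | is_derivation chi /\ exists chi',
    [/\ is_derivation chi', der_mul chi chi' = der_one
      & der_mul chi' chi = der_one]].

Definition Aut0 : set ((xm0 G -> xm0 G) * (xm1 G -> xm1 G)) :=
  [set F | [/\ is_lie_aut F.1, is_lie_aut F.2,
     forall h, F.1 (xmd h) = xmd (F.2 h)
   & forall a h, F.2 (xmact a h) = xmact (F.1 a) (F.2 h)]].

(* [A] is Aut(G) with a smooth structure making it a crossed module of Lie
   groups with smooth evaluation maps; [i0], [i1] read an element of [A] as a
   pair of automorphisms, resp. as a derivation. *)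
Record is_Aut (A : lieXMod R)
    (i0 : xm0 A -> (xm0 G -> xm0 G) * (xm1 G -> xm1 G))
    (i1 : xm1 A -> xm0 G -> xm1 G) : Prop := {
  Aut0_bij : set_bij setT Aut0 i0;
  Aut0_mul : forall F F',
    i0 (F * F')%g = ((i0 F).1 \o (i0 F').1, (i0 F).2 \o (i0 F').2);
  Aut1_bij : set_bij setT Aut1 i1;
  Aut1_mul : forall c c', i1 (c * c')%g = der_mul (i1 c) (i1 c');
  Aut_d : forall c, i0 (xmd c) =
    (fun a => (xmd (i1 c a) * a)%g, fun h => (i1 c (xmd h) * h)%g);
  Aut_act : forall F c,
    i1 (xmact F c) = (i0 F).2 \o i1 c \o (i0 F^-1%g).1;
  Aut_ev00 : smooth (fun p : xm0 A * xm0 G => (i0 p.1).1 p.2);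
  Aut_ev01 : smooth (fun p : xm0 A * xm1 G => (i0 p.1).2 p.2);
  Aut_ev1 : smooth (fun p : xm1 A * xm0 G => i1 p.1 p.2) }.

End Aut.

Section SAut.
Variables (R : realType) (g : strictLie2Alg R).
Implicit Types tau : 'Hom(lg0 g, lg1 g).

Definition SAut0 : set ('End(lg0 g) * 'End(lg1 g)) :=
  [set A : 'End(lg0 g) * 'End(lg1 g) | [/\ bijective A.1 /\ bijective A.2,
     (A.1 \o ld g = ld g \o A.2)%VF,
     forall x y, A.1 (lbr x y) = lbr (A.1 x) (A.1 y)
   & forall x a, A.2 (lact x a) = lact (A.1 x) (A.2 a)]].

Definition star tau tau' : 'Hom(lg0 g, lg1 g) :=
  tau + tau' + (tau \o ld g \o tau')%VF.

Definition SAut1 : set 'Hom(lg0 g, lg1 g) :=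
  [set tau | (exists tau', star tau tau' = 0 /\ star tau' tau = 0) /\
     forall x y, tau (lbr x y) =
       lact x (tau y) + ract (tau x) y + ract (tau x) (ld g (tau y))].

(* [S] is SAut(g), whose smooth structures are those of embedded submanifolds
   of End(g_0) x End(g_{-1}) and of Hom(g_0, g_{-1}). The latter are manifolds
   through the linear coordinates [v2r]. *)
Record is_SAut (S : lieXMod R)
    (j0 : xm0 S -> 'End(lg0 g) * 'End(lg1 g))
    (j1 : xm1 S -> 'Hom(lg0 g, lg1 g)) : Prop := {
  SAut0_bij : set_bij setT SAut0 j0;
  SAut0_mul : forall A B,
    j0 (A * B)%g = (((j0 A).1 \o (j0 B).1)%VF, ((j0 A).2 \o (j0 B).2)%VF);
  SAut0_embedding : smooth_embedding (fun A => VectorInternalTheory.v2r (j0 A));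
  SAut1_bij : set_bij setT SAut1 j1;
  SAut1_mul : forall t t', j1 (t * t')%g = star (j1 t) (j1 t');
  SAut1_embedding : smooth_embedding (fun t => VectorInternalTheory.v2r (j1 t));
  SAut_d : forall t,
    j0 (xmd t) = (\1%VF + (ld g \o j1 t)%VF, \1%VF + (j1 t \o ld g)%VF);
  SAut_act : forall A t,
    j1 (xmact A t) = ((j0 A).2 \o j1 t \o ((j0 A).1)^-1)%VF }.

End SAut.

(* The tangent map of [f] at the identity as a linear map [V -> W], read through identifications [s]
   and [t] of the Lie algebras of [G] and [H] with [V] and [W]. *)
Definition tangent_lfun (R : realType) (G H : lieGroupType R)
    (V W : vectType R) (s : 'Hom(lie G, V))
    (t : 'Hom(lie H, W)) (f : G -> H) : 'Hom(V, W) :=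
  (t \o linfun (tangent f 1%g) \o s^-1)%VF.

(* Main.v *)
(* On tangent spaces the theorem is the chain rule and the product rule, plus two
   facts needing more.

   Derivations. For [chi] in Aut^{-1}(G),
     chi(g h g^-1) = [chi(g) (g |> chi(h)) chi(g)^-1]
                     [chi(g) ((g h g^-1) |> chi(g)^-1)].
   Differentiating in [h] and then in [g] at the identity, the first factor gives
   [tau u, tau v] + u . tau v and the second one a mixed derivative of
   k (l |> k^-1). The action of the Lie algebra differentiates in [k] first, here
   [l] comes first: exchanging them (Schwarz) yields - v . tau u, hence the
   equation defining SAut^{-1}.

   Smoothness. The maps into SAut are smooth into the ambient matrix spaces,
   since parametric derivatives of the smooth evaluation maps are smooth; and a
   map into an embedded submanifold is smooth as soon as its composite with the
   embedding is. *)
Require Import Defs.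
From HB Require Import structures.
From mathcomp Require Import all_boot all_order all_algebra.
From mathcomp Require Import all_classical all_reals all_analysis.
From mathcomp Require Import ring lra.
Import Order.TTheory GRing.Theory Num.Theory.
Import numFieldNormedType.Exports.

Set Implicit Arguments.
Unset Strict Implicit.
Unset Printing Implicit Defensive.

Local Open Scope classical_set_scope.
Local Open Scope ring_scope.

(** * C^k functions *)

(** A tangent map is a differential between model spaces, read in the preferred charts at the base
    point and at its image. When the image moves, the chart moves with it, without any continuity; a
    tangent map depending on a parameter is under control only if the image of its base point stays
    fixed.

    This shapes the argument: every map that is differentiated twice (conjugation, the action, the
    factors of a derivation) is constant at the inner base point, so that all inner tangent vectors
    lie in one space, the Lie algebra. It is the reason for writing [chi (g * h * g^-1)] with two
    factors that are both 1 at [h = 1]: the plain cocycle expansion has three factors, and these are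
    not. Where [g] enters a factor in two roles, the roles become independent variables, and the
    derivative along the diagonal is the sum of the two partial ones. *)

Section Differentials.
Context {R : realType}.
Implicit Types V W : normedModType R.

Lemma diff_approx V W (f : V -> W) x : differentiable f x ->
  forall e, 0 < e ->
  \forall h \near 0, `|f (h + x) - f x - 'd f x h| <= e * `|h|.
Proof.
move=> /diff_locally/eqaddoP fx e e0.
by apply: filterS (fx _ e0) => h; rewrite -addrA -opprD.
Qed.

Lemma approx_diff V W (f : V -> W) x (L : {linear V -> W}) : continuous L ->
  (forall e, 0 < e -> \forall h \near 0, `|f (h + x) - f x - L h| <= e * `|h|) ->
  differentiable f x /\ 'd f x = L :> (V -> W).
Proof.
move=> cL fx.
have fL : f \o shift x = cst (f x) + L +o_ 0 id.
  apply/eqaddoP => e e0; apply: filterS (fx _ e0) => h.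
  by rewrite -addrA -opprD.
have dfL := diff_unique cL fL; split=> //.
by apply/diff_locallyP; rewrite dfL.
Qed.

(** A chart's two maps are inverse to each other only on its domain and image, so coordinate
    expressions agree only near the point; a differential depends only on the germ, which is enough
    to exchange them. *)
Lemma near_eq_diff V W (f g : V -> W) x : (\forall y \near x, f y = g y) ->
  differentiable f x -> differentiable g x /\ 'd g x = 'd f x :> (V -> W).
Proof.
move=> fg df; apply: approx_diff; first exact: diff_continuous.
move=> e e0; have := diff_approx df e0.
have fgx : \forall h \near 0, f (h + x) = g (h + x).
  by move: fg; rewrite (near_shift 0) subr0.
rewrite (nbhs_singleton fg); by apply: filterS2 fgx => h ->.
Qed.

End Differentials.

Section Ck.
Context {R : realType}.
Implicit Types V W : normedModType R.

(* [Cn_on] for arbitrary normed modules: its scalar-valued case is needed for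
   products and inverses. *)
Fixpoint Ck V W (k : nat) (U : set V) (f : V -> W) : Prop :=
  match k with
  | 0 => forall x, U x -> {for x, continuous f}
  | k'.+1 => (forall x, U x -> differentiable f x) /\
             (forall v, Ck k' U (fun x => 'd f x v))
  end.

Lemma Cn_onE m n k (U : set 'rV[R]_m) (f : 'rV[R]_m -> 'rV[R]_n) :
  Cn_on k U f <-> Ck k U f.
Proof.
elim: k f => [//|k IH] f /=.
by split=> -[df kf]; split=> // v; apply/IH.
Qed.

(** Derivatives are taken in the ambient space, so [Ck] on [U] is a conjunction of conditions at the
    points of [U]. *)
Lemma Ck_local V W k (U : set V) (f : V -> W) :
  (forall x, U x -> exists2 U', U' x & Ck k U' f) -> Ck k U f.
Proof.
elim: k f => [|k IH] f Uf /=.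
  by move=> x /Uf[U' U'x]; apply.
split=> [x /Uf[U' U'x [+ _]]|v]; first exact.
by apply: IH => x /Uf[U' U'x [_ kf]]; exists U'; [|exact: kf].
Qed.

Lemma Ck_sub V W k (U U' : set V) (f : V -> W) :
  U `<=` U' -> Ck k U' f -> Ck k U f.
Proof. by move=> UU' kf; apply: Ck_local => x /UU' U'x; exists U'. Qed.

(** Openness turns equality on [U] into equality of germs, hence of differentials on [U], and the
    induction goes on with these. *)
Lemma Ck_eq V W k (U : set V) (f g : V -> W) : open U ->
  (forall x, U x -> f x = g x) -> Ck k U f -> Ck k U g.
Proof.
move=> oU; have nU x : U x -> nbhs x U by move=> Ux; apply: open_nbhs_nbhs.
elim: k f g => [|k IH] f g fg /=.
  move=> kf x Ux; have fgx : \forall y \near x, f y = g y.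
    exact: filterS (nU _ Ux).
  rewrite /prop_for /continuous_at -(fg _ Ux).
  by apply: cvg_trans (kf x Ux); apply: near_eq_cvg.
have fgx x : U x -> \forall y \near x, f y = g y.
  by move=> Ux; apply: filterS (nU _ Ux).
move=> [df kf]; split=> [x Ux|v].
  by have [] := near_eq_diff (fgx _ Ux) (df _ Ux).
apply: IH (kf v) => x Ux.
by have [_ ->] := near_eq_diff (fgx _ Ux) (df _ Ux).
Qed.

Lemma CkW V W k (U : set V) (f : V -> W) : Ck k.+1 U f -> Ck k U f.
Proof.
elim: k f => [|k IH] f [df kf].
  by move=> x Ux; apply/differentiable_continuous/df.
by split=> // v; apply: IH.
Qed.

Lemma Ck_diff V W k (U : set V) (f : V -> W) x :
  Ck k.+1 U f -> U x -> differentiable f x.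
Proof. by case=> df _ /df. Qed.

Lemma Ck_continuous V W k (U : set V) (f : V -> W) x :
  Ck k U f -> U x -> {for x, continuous f}.
Proof.
case: k => [|k]; first exact.
by move=> kf Ux; apply/differentiable_continuous/(Ck_diff kf).
Qed.

Lemma Ck_cst V W k (U : set V) (w : W) : Ck k U (fun=> w).
Proof.
elim: k w => [|k IH] w /=; first by move=> x _; apply: cvg_cst.
split=> [x _|v]; first exact: differentiable_cst.
under eq_fun do rewrite (_ : (fun=> w) = cst w)// diff_cst.
exact: IH.
Qed.

Lemma Ck_linear V W W' k (U : set V) (f : V -> W) (L : {linear W -> W'}) :
  open U -> continuous L -> Ck k U f -> Ck k U (fun x => L (f x)).
Proof.
move=> oU cL; elim: k f => [|k IH] f /=.
  by move=> kf x Ux; apply: continuous_comp; [exact: kf|exact: cL].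
have dL y := linear_differentiable y cL.
move=> [df kf]; split=> [x Ux|v].
  exact: (differentiable_comp (df x Ux) (dL (f x))).
apply: Ck_eq (IH _ (kf v)) => // x Ux.
by rewrite (diff_comp (df x Ux) (dL (f x)))/= diff_lin.
Qed.

Lemma Ck_id V k (U : set V) : open U -> Ck k U (@id V).
Proof.
case: k => [|k] oU /=; first by move=> x _; apply: cvg_id.
split=> // v; apply: Ck_eq (Ck_cst _ _ v) => // x _.
by rewrite diff_val.
Qed.

Lemma Ck_lin V W k (U : set V) (L : {linear V -> W}) :
  open U -> continuous L -> Ck k U L.
Proof. by move=> oU cL; apply: (Ck_linear oU cL); exact: Ck_id. Qed.

Lemma Ck_add V W k (U : set V) (f g : V -> W) : open U ->
  Ck k U f -> Ck k U g -> Ck k U (fun x => f x + g x).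
Proof.
move=> oU; elim: k f g => [|k IH] f g /=.
  by move=> kf kg x Ux; apply: continuousD; [apply: kf|apply: kg].
move=> [df kf] [dg kg]; split=> [x Ux|v].
  exact: (differentiableD (df x Ux) (dg x Ux)).
apply: Ck_eq (IH _ _ (kf v) (kg v)) => // x Ux.
exact: esym (congr1 (@^~ v) (diffD (df x Ux) (dg x Ux))).
Qed.

Lemma Ck_sum V W k (U : set V) (I : Type) (r : seq I) (P : pred I)
    (f : I -> V -> W) : open U ->
  (forall i, Ck k U (f i)) -> Ck k U (fun x => \sum_(i <- r | P i) f i x).
Proof.
move=> oU kf; elim: r => [|i r IH].
  by under eq_fun do rewrite big_nil; apply: Ck_cst.
under eq_fun do rewrite big_cons.
by case: (P i) => //; apply: Ck_add.
Qed.

Lemma Ck_mul V k (U : set V) (f g : V -> R) : open U ->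
  Ck k U f -> Ck k U g -> Ck k U (fun x => f x * g x).
Proof.
move=> oU; elim: k f g => [|k IH] f g.
  by move=> kf kg x Ux; apply: continuousM; [exact: kf|exact: kg].
move=> kf' kg'; have [df kf] := kf'; have [dg kg] := kg'.
split=> [x Ux|v]; first exact: (differentiableM (df x Ux) (dg x Ux)).
have kfg : Ck k U (fun x => f x * 'd g x v + g x * 'd f x v).
  apply: Ck_add => //; apply: IH; first exact: (CkW kf').
  - exact: kg.
  - exact: (CkW kg').
  - exact: kf.
apply: Ck_eq kfg => // x Ux.
exact: esym (congr1 (@^~ v) (diffM (df x Ux) (dg x Ux))).
Qed.

Lemma Ck_prod V k (U : set V) (I : Type) (r : seq I) (P : pred I)
    (f : I -> V -> R) : open U ->
  (forall i, Ck k U (f i)) -> Ck k U (fun x => \prod_(i <- r | P i) f i x).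
Proof.
move=> oU kf; elim: r => [|i r IH].
  by under eq_fun do rewrite big_nil; apply: Ck_cst.
under eq_fun do rewrite big_cons.
by case: (P i) => //; apply: Ck_mul.
Qed.

(** Bootstrapping: the derivative of [1 / f] is [- f^-2] times that of [f], and so involves [1 / f]
    only to the order already reached. *)
Lemma Ck_inv V k (U : set V) (f : V -> R) : open U ->
  (forall x, U x -> f x != 0) -> Ck k U f -> Ck k U (fun x => (f x)^-1).
Proof.
move=> oU f0; elim: k => [|k IH].
  by move=> kf x Ux; apply: continuousV; [exact: f0|exact: kf].
move=> kf; have /IH kfV := CkW kf; case: kf => df kf.
split=> [x Ux|v]; first exact: (differentiableV (df x Ux) (f0 x Ux)).
have kg : Ck k U (fun x => - 1 * ((f x)^-1 * (f x)^-1) * 'd f x v).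
  apply: Ck_mul (kf v) => //; apply: Ck_mul; [by []|exact: Ck_cst|].
  exact: Ck_mul.
apply: Ck_eq kg => // x Ux.
have dV := congr1 (@^~ v) (diffV (df x Ux) (f0 x Ux)).
rewrite mulN1r -invfM -expr2; exact: esym dV.
Qed.

End Ck.

(** * Row vectors: coordinates, composition, matrix inversion *)

Section CkRow.
Context {R : realType}.
Implicit Types V W : normedModType R.

Lemma linear_rV_sum W n (L : {linear 'rV[R]_n -> W}) v :
  L v = \sum_j v 0 j *: L (delta_mx 0 j).
Proof.
rewrite [v in LHS]row_sum_delta linear_sum.
by apply: eq_bigr => j _; rewrite linearZ.
Qed.

Lemma linear_rV_continuous W n (L : {linear 'rV[R]_n -> W}) : continuous L.
Proof.
suff cL r : forall x : 'rV[R]_n,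
    continuous_at x (fun v : 'rV[R]_n => \sum_(j <- r) v 0 j *: L (delta_mx 0 j)).
  move=> x; rewrite (funext (linear_rV_sum L) : (L : 'rV[R]_n -> W) = _).
  exact: cL.
elim: r => [|j r IH] x.
  by under eq_fun do rewrite big_nil; exact: cst_continuous.
under eq_fun do rewrite big_cons.
have cx : (fun v : 'rV[R]_n => v 0 j) @ x --> x 0 j by exact: coord_continuous.
have cL := @cvgZr_tmp _ _ _ _ (nbhs_filter x) _ _ (L (delta_mx 0 j)) cx.
exact: (@cvgD _ _ _ _ (nbhs_filter x) _ _ _ _ cL (IH x)).
Qed.

Definition linear_pack V W (L : V -> W) (hL : linear L) : {linear V -> W} :=
  HB.pack L (GRing.isLinear.Build _ _ _ _ L hL).

Lemma coord_linear n (j : 'I_n) :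
  linear (fun v : 'rV[R]_n => v 0 j : R).
Proof. by move=> a u v; rewrite !mxE. Qed.

Lemma scalel_linear W (w : W) : linear (fun a : R => a *: w).
Proof. by move=> a u v; rewrite scalerDl scalerA. Qed.

Lemma Ck_coord V n k (U : set V) (f : V -> 'rV[R]_n) j : open U ->
  Ck k U f -> Ck k U (fun x => f x 0 j : R).
Proof.
move=> oU kf.
apply: (Ck_linear (L := linear_pack (coord_linear j)) oU _ kf).
exact: linear_rV_continuous.
Qed.

Lemma Ck_scalel V W k (U : set V) (f : V -> R) (w : W) : open U ->
  Ck k U f -> Ck k U (fun x => f x *: w).
Proof.
move=> oU kf.
apply: (Ck_linear (L := linear_pack (scalel_linear w)) oU _ kf).
exact: scalel_continuous.
Qed.

Lemma Ck_rV V n k (U : set V) (f : V -> 'rV[R]_n) : open U ->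
  (forall j, Ck k U (fun x => f x 0 j : R)) -> Ck k U f.
Proof.
move=> oU kf; rewrite (_ : f = fun x => \sum_j f x 0 j *: delta_mx 0 j).
  by apply: Ck_sum => // j; apply: Ck_scalel.
by apply/funext => x; rewrite -row_sum_delta.
Qed.

Lemma Ck_row_mx V m n k (U : set V) (f : V -> 'rV[R]_m) (g : V -> 'rV[R]_n) :
  open U -> Ck k U f -> Ck k U g -> Ck k U (fun x => row_mx (f x) (g x)).
Proof.
move=> oU kf kg; apply: Ck_rV => // j.
rewrite -[j]splitK; case: (fintype.split j) => i /=.
  by under eq_fun do rewrite row_mxEl; apply: Ck_coord.
by under eq_fun do rewrite row_mxEr; apply: Ck_coord.
Qed.

Lemma Ck_scale V n k (U : set V) (f : V -> R) (g : V -> 'rV[R]_n) : open U ->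
  Ck k U f -> Ck k U g -> Ck k U (fun x => f x *: g x).
Proof.
move=> oU kf kg; apply: Ck_rV => // j.
under eq_fun do rewrite mxE.
by apply: Ck_mul => //; apply: Ck_coord.
Qed.

Lemma Ck_comp V m n k (U : set V) (U' : set 'rV[R]_m)
    (f : V -> 'rV[R]_m) (g : 'rV[R]_m -> 'rV[R]_n) :
  open U -> open U' -> (forall x, U x -> U' (f x)) ->
  Ck k U f -> Ck k U' g -> Ck k U (g \o f).
Proof.
move=> oU oU' fU; elim: k g => [|k IH] g.
  by move=> kf kg x Ux; apply: continuous_comp; [exact: kf|apply/kg/fU].
move=> kf; have := CkW kf; case: kf => df kf kf' [dg kg].
split=> [x Ux|v]; first exact: (differentiable_comp (df x Ux) (dg _ (fU _ Ux))).
(* [Ck] speaks of derivatives in a fixed direction, whereas the chain rule applies ['d g (f x)] to a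
   vector varying with [x]; expanding that vector in the standard basis leaves fixed directions with
   scalar coefficients. *)
have kdgf : Ck k U (fun x => \sum_j ('d f x v) 0 j *: 'd g (f x) (delta_mx 0 j)).
  apply: Ck_sum => // j; apply: Ck_scale => //; first exact: Ck_coord (kf v).
  exact: (IH (fun y => 'd g y (delta_mx 0 j)) kf' (kg _)).
apply: Ck_eq kdgf => // x Ux.
by rewrite (diff_comp (df x Ux) (dg _ (fU _ Ux)))/= [RHS]linear_rV_sum.
Qed.

Lemma Ck_det V n k (U : set V) (M : V -> 'M[R]_n) : open U ->
  (forall i j, Ck k U (fun x => M x i j : R)) ->
  Ck k U (fun x => \det (M x) : R).
Proof.
move=> oU kM; apply: Ck_sum => // s.
by apply: Ck_mul => //; [exact: Ck_cst|exact: Ck_prod].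
Qed.

Lemma Ck_cofactor V n k (U : set V) (M : V -> 'M[R]_n) a b : open U ->
  (forall i j, Ck k U (fun x => M x i j : R)) ->
  Ck k U (fun x => cofactor (M x) a b : R).
Proof.
move=> oU kM; apply: Ck_mul => //; first exact: Ck_cst.
by apply: Ck_det => // i j; under eq_fun do rewrite !mxE.
Qed.

Lemma Ck_invmx V n k (U : set V) (M : V -> 'M[R]_n) a b : open U ->
  (forall x, U x -> M x \in unitmx) ->
  (forall i j, Ck k U (fun x => M x i j : R)) ->
  Ck k U (fun x => (invmx (M x)) a b : R).
Proof.
move=> oU uM kM.
(* Cramer's rule; the indices are exchanged because the adjugate is the transpose of the cofactor
   matrix. *)
have kV : Ck k U (fun x => (\det (M x))^-1 * cofactor (M x) b a).
  apply: Ck_mul => //; last exact: Ck_cofactor.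
  apply: Ck_inv => //; last exact: Ck_det.
  by move=> x /uM; rewrite unitmxE unitfE.
by apply: Ck_eq kV => // x Ux; rewrite /invmx uM// !mxE.
Qed.

End CkRow.

(** * Symmetry of second derivatives *)

Section Schwarz.
Context {R : realType}.
Implicit Types V W : normedModType R.

Lemma is_derive_line V (f : V -> R) c w (t : R) : differentiable f (c + t *: w) ->
  is_derive t 1 (fun s : R => f (c + s *: w)) ('d f (c + t *: w) w).
Proof.
move=> df.
pose l : R -> V := cst c + ( *:%R^~ w).
have dl : is_diff t l (0 + ( *:%R^~ w)) by exact: is_diffD.
have [dfl dflE] := is_diff_comp dl (differentiableP df : is_diff (l t) f _).
rewrite -[fun s => _]/(f \o l).
split; first exact: diff_derivable.
rewrite deriveE// dflE/=.
by congr ('d f _ _); rewrite -[LHS]/(0 + 1 *: w) add0r scale1r.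
Qed.

(** The mean value theorem twice: first along [u] for the difference of [f] on two opposite sides of
    the parallelogram, then along [v] for the derivative of [f] in direction [u]. *)
Lemma second_difference V (f : V -> R) (U : set V) x u v (s : R) : 0 < s ->
  Ck 2 U f ->
  (forall a b : R, 0 <= a <= s -> 0 <= b <= s -> U (x + a *: u + b *: v)) ->
  exists a b, [/\ 0 <= a <= s, 0 <= b <= s &
    f (x + s *: u + s *: v) - f (x + s *: u) - f (x + s *: v) + f x =
    'd (fun y => 'd f y u) (x + a *: u + b *: v) v * s ^+ 2].
Proof.
move=> s0 [df /(_ u)[ddf _]] Us.
have U0 a : 0 <= a <= s -> U (x + a *: u).
  by move=> aI; have := Us a 0 aI; rewrite scale0r addr0 lexx ltW//; apply.
have inI (a : R) : a \in `[0, s]%R -> 0 <= a <= s by rewrite in_itv.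
have sI : 0 <= s <= s by rewrite lexx ltW.
pose g a := f ((x + s *: v) + a *: u) - f (x + a *: u).
pose g' a := 'd f ((x + s *: v) + a *: u) u - 'd f (x + a *: u) u.
have dg a : a \in `[0, s]%R -> is_derive a 1 g (g' a).
  move=> /inI aI; apply: is_deriveB; apply: is_derive_line; apply: df.
    by rewrite addrAC; apply: Us.
  exact: U0.
have dgo a (aI : a \in `]0, s[%R) : is_derive a 1 g (g' a).
  exact: dg (subset_itv_oo_cc aI).
have cg : {within `[0, s], continuous g}.
  by apply: derivable_within_continuous => a /dg[].
have [a /inI aI gE] := MVT_segment (ltW s0) dgo cg.
pose k b := 'd f (x + a *: u + b *: v) u.
pose k' b := 'd (fun y => 'd f y u) (x + a *: u + b *: v) v.
have dk b : b \in `[0, s]%R -> is_derive b 1 k (k' b).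
  by move=> /inI bI; apply: is_derive_line; apply: ddf; apply: Us.
have dko b (bI : b \in `]0, s[%R) : is_derive b 1 k (k' b).
  exact: dk (subset_itv_oo_cc bI).
have ck : {within `[0, s], continuous k}.
  by apply: derivable_within_continuous => b /dk[].
have [b /inI bI kE] := MVT_segment (ltW s0) dko ck.
exists a, b; split=> //.
rewrite expr2 mulrA -[X in X * s * s]/(k' b).
have -> : k' b * s = g' a.
  by rewrite -[s]subr0 -kE /k /g' scale0r addr0 [x + s *: v + _]addrAC.
rewrite -[X in _ * X]subr0 -gE /g scale0r !addr0 [x + s *: u + _]addrAC.
ring.
Qed.

(** The second difference is symmetric in [u] and [v], so the two mixed derivatives take a common
    value at two points of an arbitrarily small parallelogram; continuity brings both points to
    [x]. *)
Lemma diff2_sym_real V (f : V -> R) (U : set V) x u v :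
  open U -> U x -> Ck 2 U f ->
  'd (fun y => 'd f y u) x v = 'd (fun y => 'd f y v) x u.
Proof.
move=> oU Ux kf.
have c2 w w' : {for x, continuous (fun y => 'd (fun y => 'd f y w) y w')}.
  by case: kf => _ /(_ w)[_ /(_ w') +]; apply.
apply/eqP; rewrite -subr_eq0 -normr_eq0; apply/eqP/le_anti.
rewrite normr_ge0 andbT; apply/ler_addgt0Pr => e e0; rewrite add0r.
have e2 : 0 < e / 2 by lra.
have /cvgrPdist_lt/(_ _ e2) uvx := c2 u v.
have /cvgrPdist_lt/(_ _ e2) vux := c2 v u.
have nUx : nbhs x U by exact: open_nbhs_nbhs.
have [r /= r0 Br] := (nbhs_ballP x _).1 (filterI nUx (filterI uvx vux)).
(* Points of the parallelogram of side parameter [s] are at distance at most [s * m], which is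
   [r / 2], from [x]; the summand 1 keeps [m] positive when [u] and [v] vanish. *)
pose m := `|u| + `|v| + 1.
have m0 : 0 < m by rewrite /m; have := normr_ge0 u; have := normr_ge0 v; lra.
pose s := r / (m + m).
have s0 : 0 < s by rewrite divr_gt0// addr_gt0.
have near a b w w' : `|w| + `|w'| + 1 = m -> 0 <= a <= s -> 0 <= b <= s ->
    ball x r (x + a *: w + b *: w').
  move=> wm /andP[a0 as_] /andP[b0 bs].
  rewrite -ball_normE /= opprD addrA opprD addrA subrr sub0r -opprD normrN.
  apply: le_lt_trans (ler_normD _ _) _; rewrite !normrZ !ger0_norm//.
  have aw : a * `|w| <= s * `|w| by apply: ler_wpM2r.
  have bw : b * `|w'| <= s * `|w'| by apply: ler_wpM2r.
  have sm : s * (m + m) = r by rewrite /s divfK// gt_eqF// addr_gt0.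
  have sm0 : 0 < s * m by rewrite mulr_gt0.
  have : s * `|w| + s * `|w'| <= s * m by rewrite -wm !mulrDr; lra.
  rewrite mulrDr in sm; lra.
have uvm : `|u| + `|v| + 1 = m by [].
have vum : `|v| + `|u| + 1 = m by rewrite /m [`|v| + _]addrC.
have [a [b [aI bI Duv]]] := second_difference s0 kf
  (fun a b aI bI => (Br _ (near _ _ _ _ uvm aI bI)).1).
have [c [d [cI dI Dvu]]] := second_difference s0 kf
  (fun a b aI bI => (Br _ (near _ _ _ _ vum aI bI)).1).
have E : 'd (fun y => 'd f y u) (x + a *: u + b *: v) v =
         'd (fun y => 'd f y v) (x + c *: v + d *: u) u.
  have s20 : s ^+ 2 != 0 by rewrite expf_neq0// gt_eqF.
  apply: (mulIf s20); rewrite -Duv -Dvu.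
  by rewrite [x + s *: v + s *: u]addrAC [_ - _ - f (x + s *: v)]addrAC.
have [_ [+ _]] := Br _ (near _ _ _ _ uvm aI bI).
have [_ [_ +]] := Br _ (near _ _ _ _ vum cI dI).
rewrite /= E => h1 h2.
set A := 'd _ x v in h1 h2 *; set B := 'd _ x u in h1 h2 *.
set C := 'd _ _ _ in h1 h2.
have -> : A - B = (A - C) - (B - C) by rewrite opprB addrA subrK.
apply: le_trans (ler_normB _ _) _; lra.
Qed.

Lemma diff_coord V n (f : V -> 'rV[R]_n) x v j : differentiable f x ->
  'd (fun y => f y 0 j : R) x v = 'd f x v 0 j.
Proof.
move=> df.
have cL : continuous (linear_pack (coord_linear j) : 'rV[R]_n -> R).
  exact: linear_rV_continuous.
rewrite -[fun y => _]/(linear_pack (coord_linear j) \o f).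
have dL := linear_differentiable (f x) cL.
by rewrite (diff_comp df dL); exact: (congr1 (@^~ ('d f x v)) (diff_lin (f x) cL)).
Qed.

Lemma diff2_sym V n (f : V -> 'rV[R]_n) (U : set V) x u v :
  open U -> U x -> Ck 2 U f ->
  'd (fun y => 'd f y u) x v = 'd (fun y => 'd f y v) x u.
Proof.
move=> oU Ux kf; apply/rowP => j.
have [df ddf] := kf.
have nU : nbhs x U by exact: open_nbhs_nbhs.
have fj w : differentiable (fun y => 'd f y w) x by have [+ _] := ddf w; apply.
have fjE w w' : 'd (fun y => 'd f y w) x w' 0 j =
    'd (fun y => 'd (fun z => f z 0 j : R) y w) x w'.
  rewrite -(diff_coord _ _ (fj w)).
  have dfj : differentiable (fun y => 'd f y w 0 j : R) x.
    exact: (differentiable_comp (fj w) (differentiable_coord ('d f x w) 0 j)).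
  have [] := near_eq_diff (g := fun y => 'd (fun z => f z 0 j : R) y w) _ dfj.
    by apply: filterS nU => y Uy; rewrite diff_coord//; apply: df.
  by move=> _ ->.
by rewrite !fjE; apply: (diff2_sym_real _ _ oU Ux); apply: Ck_coord.
Qed.

End Schwarz.

(** * Lifting smooth maps through immersions *)

Section Immersion.
Context {R : realType}.
Implicit Types V W : normedModType R.

Lemma Ck_mulmx V k (U : set V) m n p (A : V -> 'M[R]_(m, n))
    (B : V -> 'M[R]_(n, p)) : open U ->
  (forall i j, Ck k U (fun x => A x i j : R)) ->
  (forall i j, Ck k U (fun x => B x i j : R)) ->
  forall i j, Ck k U (fun x => (A x *m B x) i j : R).
Proof.
move=> oU kA kB i j; under eq_fun do rewrite mxE.
by apply: Ck_sum => // l; apply: Ck_mul.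
Qed.

(** If [v J J^T = 0], then [v J] times its own transpose is 0, a sum of squares, so [v J = 0] and
    injectivity applies. *)
Lemma gram_unitmx n p (J : 'M[R]_(n, p)) :
  injective (mulmx^~ J : 'rV_n -> 'rV_p) -> J *m J^T \in unitmx.
Proof.
move=> injJ; rewrite -row_free_unit; apply: inj_row_free => v vJ.
apply: injJ; rewrite mul0mx; apply/rowP => j; rewrite !mxE.
have : (v *m J *m (v *m J)^T) 0 0 = 0.
  by rewrite trmx_mul !mulmxA -(mulmxA v) vJ mul0mx mxE.
rewrite mxE => /eqP; rewrite psumr_eq0; last first.
  by move=> i _; rewrite [_^T _ _]mxE -expr2 sqr_ge0.
move=> /allP/(_ j (mem_index_enum _)).
by rewrite [_^T _ _]mxE -expr2 sqrf_eq0 mxE => /eqP.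
Qed.

(* The Moore-Penrose left inverse of a full rank [J]; its entries are rational
   functions of those of [J], hence it depends smoothly on [J]. *)
Definition left_invmx n p (J : 'M[R]_(n, p)) : 'M[R]_(p, n) :=
  J^T *m invmx (J *m J^T).

Lemma left_invmxK n p (J : 'M[R]_(n, p)) :
  injective (mulmx^~ J : 'rV_n -> 'rV_p) -> J *m left_invmx J = 1%:M.
Proof. by move=> injJ; rewrite mulmxA mulmxV ?gram_unitmx. Qed.

Lemma diff_jacobian m n (f : 'rV[R]_m -> 'rV[R]_n) x v :
  'd f x v = v *m jacobian f x.
Proof. by rewrite mul_rV_lin1. Qed.

Section Lift.
Variables (m n p : nat) (f : 'rV[R]_m -> 'rV[R]_n) (phi : 'rV[R]_n -> 'rV[R]_p).

(* No inverse function theorem is needed: with [B] a left inverse of the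
   differential of [phi] and [k := f (h + x) - f x], applying [B] to
   [phi (k + f x) - phi (f x) = 'd phi (f x) k + o(k)] yields first [k = O(h)]
   and then [k = B ('d (phi \o f) x h) + o(h)]. *)
Lemma differentiable_lift (x : 'rV[R]_m) : {for x, continuous f} ->
  differentiable phi (f x) -> injective ('d phi (f x)) ->
  differentiable (phi \o f) x ->
  differentiable f x /\ forall v,
    'd f x v = 'd (phi \o f) x v *m left_invmx (jacobian phi (f x)).
Proof.
move=> cf dphi injphi dh.
set J := jacobian phi (f x); set B := left_invmx J.
have DB k : 'd phi (f x) k *m B = k.
  rewrite diff_jacobian -mulmxA left_invmxK ?mulmx1// => a b.
  by rewrite -!diff_jacobian => /injphi.
have [c c0 cB] := @linear_lipschitz R _ _ (mulmxr B : {linear 'rV[R]_p -> 'rV[R]_n})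
  (@linear_rV_continuous _ _ _ _).
have [C C0 CD] := linear_lipschitz (diff_continuous dh).
pose L : {linear 'rV[R]_m -> 'rV[R]_n} := mulmxr B \o 'd (phi \o f) x.
have [] := @approx_diff R _ _ f x L; [exact: linear_rV_continuous| |].
  move=> e e0.
  (* [c] bounds multiplication by [B], and [C] bounds the differential of [phi \o f], whose
     increment is then at most [(C + 1) * |h|] near 0. With [c * e2 <= 1/2] this gives
     [|k| <= c * (C + 1) * |h| + |k| / 2], hence [|k| <= D * |h|]. The final error is
     [c * e1 * |h| + c * e2 * D * |h|], where each term is at most [e / 2 * |h|]. *)
  pose D := 2 * c * (C + 1).
  have D0 : 0 < D by rewrite !mulr_gt0// addr_gt0.
  pose e1 := e / (2 * c).
  have e10 : 0 < e1 by rewrite divr_gt0// mulr_gt0.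
  pose e2 := Num.min (2 * c)^-1 (e / (2 * c * D)).
  have e20 : 0 < e2.
    rewrite lt_min invr_gt0 mulr_gt0//=.
    by apply: divr_gt0 => //; apply: mulr_gt0 => //; apply: mulr_gt0.
  have N0 : Filter (nbhs (0 : 'rV[R]_m)) := nbhs_filter _.
  have fk : \forall h \near (0 : 'rV[R]_m),
      `|phi (f (h + x)) - phi (f x) - 'd phi (f x) (f (h + x) - f x)| <=
        e2 * `|f (h + x) - f x|.
    have := diff_approx dphi e20.
    rewrite (near_shift (f x)) sub0r => Pf.
    have : \forall y \near x, `|phi (f y - f x + f x) - phi (f x) -
        'd phi (f x) (f y - f x)| <= e2 * `|f y - f x| by exact: cf _ Pf.
    rewrite (near_shift 0) subr0.
    by apply: (@filterS _ _ N0) => h /=; rewrite subrK.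
  have fk3 := @filterI _ _ N0 _ _ fk
    (@filterI _ _ N0 _ _ (diff_approx dh e10) (diff_approx dh ltr01)).
  apply: (@filterS _ _ N0 _ _ _ fk3) => h [].
  rewrite /= mul1r; set k := f (h + x) - f x.
  set dphi_h := phi _ - phi _; set Dh := 'd (phi \o f) x h => r1 [r2 r3].
  (* Since [B] undoes the differential of [phi], [k] is the image under [B] of the increment of
     [phi] minus its remainder. *)
  have kE : k = dphi_h *m B - (dphi_h - 'd phi (f x) k) *m B.
    by rewrite [(dphi_h - _) *m B]mulmxBl DB opprB addrCA subrr addr0.
  have n1 := cB (dphi_h - 'd phi (f x) k).
  have n2 := cB (dphi_h - Dh).
  have n3 := cB dphi_h.
  rewrite /= in n1 n2 n3.
  have n4 := CD h; rewrite -/Dh in n4.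
  have dphiC : `|dphi_h| <= (C + 1) * `|h|.
    rewrite -[dphi_h](subrK Dh); apply: le_trans (ler_normD _ _) _; lra.
  have k0 := normr_ge0 k; have h0 := normr_ge0 h.
  have ce2 : c * e2 <= 2^-1.
    have : e2 <= (2 * c)^-1 by rewrite ge_min lexx.
    have <- : c * (2 * c)^-1 = 2^-1 by field; rewrite gt_eqF.
    by rewrite ler_pM2l.
  have ce2D : c * e2 * D <= e / 2.
    have : e2 <= e / (2 * c * D) by rewrite ge_min lexx orbT.
    rewrite ler_pdivlMr ?mulr_gt0//; lra.
  have n5 : `|(dphi_h - 'd phi (f x) k) *m B| <= c * e2 * `|k|.
    by apply: le_trans n1 _; rewrite -mulrA ler_pM2l.
  have kD : `|k| <= D * `|h|.
    have : `|k| <= c * ((C + 1) * `|h|) + 2^-1 * `|k|.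
      rewrite {1}kE; apply: le_trans (ler_normB _ _) _; apply: lerD.
        by apply: le_trans n3 _; rewrite ler_pM2l.
      by apply: le_trans n5 _; apply: ler_wpM2r.
    rewrite /D; lra.
  have -> : k - L h = (dphi_h - Dh) *m B - (dphi_h - 'd phi (f x) k) *m B.
    by rewrite {1}kE /= -/Dh [(dphi_h - Dh) *m B]mulmxBl addrAC.
  apply: le_trans (ler_normB _ _) _.
  have n6 : `|(dphi_h - Dh) *m B| <= e / 2 * `|h|.
    apply: le_trans n2 _; have : c * e1 = e / 2.
      by rewrite /e1; field; rewrite gt_eqF.
    by move=> <-; rewrite -mulrA ler_pM2l.
  have n7 : c * e2 * `|k| <= e / 2 * `|h|.
    have : c * e2 * `|k| <= c * e2 * (D * `|h|).
      by apply: ler_wpM2l => //; rewrite mulr_ge0// ltW.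
    have : c * e2 * D * `|h| <= e / 2 * `|h| by apply: ler_wpM2r.
    lra.
  lra.
by move=> df dfE; split=> // v; rewrite dfE.
Qed.

(** Bootstrapping on the formula of [differentiable_lift]: its right-hand side involves [f] only
    through the Jacobian of [phi] at [f x], so [f] of class C^k gives a derivative of class C^k. *)
Lemma smooth_lift (U : set 'rV[R]_m) (U' : set 'rV[R]_n) : open U -> open U' ->
  (forall x, U x -> U' (f x)) -> (forall x, U x -> {for x, continuous f}) ->
  smooth_on U' phi -> (forall y, U' y -> injective ('d phi y)) ->
  smooth_on U (phi \o f) -> smooth_on U f.
Proof.
move=> oU oU' fU cf sphi injphi sh k; apply/Cn_onE.
have kphi j : Ck j U' phi by apply/Cn_onE.
have kh j : Ck j U (phi \o f) by apply/Cn_onE.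
have dfU x (Ux : U x) := differentiable_lift (cf x Ux)
  (Ck_diff (kphi 1) (fU x Ux)) (injphi _ (fU x Ux)) (Ck_diff (kh 1) Ux).
elim: k => [|k IH]; first exact: cf.
split=> [x Ux|v]; first by have [] := dfU x Ux.
have kdf : Ck k U (fun x => 'd (phi \o f) x v *m left_invmx (jacobian phi (f x))).
  have kJ i j : Ck k U (fun x => jacobian phi (f x) i j : R).
    under eq_fun do rewrite mxE.
    apply: Ck_coord => //.
    apply: (Ck_comp oU oU' fU IH (g := fun y => 'd phi y (delta_mx 0 i))).
    by have [_] := kphi k.+1; apply.
  have kJt i j : Ck k U (fun x => (jacobian phi (f x))^T i j : R).
    by under eq_fun do rewrite mxE.
  apply: Ck_rV => // j; apply: Ck_mulmx => // [i l|].
    by rewrite ord1; apply: Ck_coord => //; have [_] := kh k.+1; apply.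
  apply: Ck_mulmx => // i l; apply: Ck_invmx => // [x Ux|]; last exact: Ck_mulmx.
  apply: gram_unitmx => a b; rewrite -!diff_jacobian.
  exact: (injphi _ (fU x Ux)).
by apply: Ck_eq kdf => // x Ux; have [_ ->] := dfU x Ux.
Qed.

End Lift.
End Immersion.

(** * Smooth maps and tangent maps in charts *)

Section Charts.
Context {R : realType}.

Lemma chart_open_image (M : topologicalType) n (c : chart R M n) (V : set M) :
  is_chart c -> open V -> open (cmap c @` (cdom c `&` V)).
Proof.
move=> [od oi cK cc ci] oV.
rewrite (_ : _ @` _ = cimg c `&` cinv c @^-1` V).
  rewrite continuous_open_subspace// in ci.
  exact: (continuous_inP _ oi).1 ci _ oV.
apply/seteqP; split=> [_ [p [dp Vp] <-]|_ [[p dp <-]]] /=.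
  by split; [exists p|rewrite /= cK// inE].
by rewrite /= cK ?inE// => Vp; exists p.
Qed.

Lemma cmap_continuous (M : topologicalType) n (c : chart R M n) p :
  is_chart c -> cdom c p -> {for p, continuous (cmap c)}.
Proof.
move=> [od _ _ + _] dp; rewrite continuous_open_subspace//.
by apply; rewrite inE.
Qed.

Lemma cmapK (M : topologicalType) n (c : chart R M n) p :
  is_chart c -> cdom c p -> cinv c (cmap c p) = p.
Proof. by move=> [_ _ cK _ _] dp; rewrite cK// inE. Qed.

Lemma cinvP (M : topologicalType) n (c : chart R M n) x :
  is_chart c -> cimg c x -> cdom c (cinv c x) /\ cmap c (cinv c x) = x.
Proof. by move=> hc [p dp <-]; rewrite cmapK. Qed.

Lemma smooth_onE m n (U : set 'rV[R]_m) (f : 'rV[R]_m -> 'rV[R]_n) :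
  smooth_on U f <-> forall k, Ck k U f.
Proof. by split=> + k => /(_ k)/Cn_onE. Qed.

(* The part of the manifold axioms used below, stated as a predicate because
   products of manifolds are only [chartedType]s. *)
Record well_charted (M : chartedType R) : Prop := {
  wc_chart : forall c, atlas M c -> is_chart c;
  wc_atlas : forall p : M, atlas M (chart_at p);
  wc_dom : forall p : M, cdom (chart_at p) p;
  wc_id : smooth (fun x : M => x) }.

Lemma manifold_well_charted (M : manifoldType R) : well_charted M.
Proof.
split.
- exact: manifold_is_chart.
- exact: manifold_chart_at.
- exact: manifold_chart_at_dom.
- by split=> [|c c' ac ac']; [move=> x; apply: cvg_id|exact: manifold_compatible].
Qed.

Lemma rV_well_charted n : well_charted 'rV[R]_n.
Proof.
split=> //.
- move=> c ->; rewrite /is_chart /cimg/= image_id.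
  by split=> //; try exact: openT; apply: continuous_subspaceT => x; apply: cvg_id.
- split=> [|c c' -> ->]; first by move=> x; apply: cvg_id.
  apply/smooth_onE => k /=; apply: Ck_id.
  by rewrite setTI preimage_setT image_id; exact: openT.
Qed.

Lemma smooth_comp (M N P : chartedType R) (g : N -> P) (f : M -> N) :
  well_charted M -> well_charted N -> well_charted P ->
  smooth g -> smooth f -> smooth (fun x => g (f x)).
Proof.
move=> wM wN wP [cg sg] [cf sf].
have cgf : continuous (fun x => g (f x)).
  by move=> x; apply: continuous_comp; [exact: cf|exact: cg].
split=> // c c' ac ac'; apply/smooth_onE => k.
have hc := wc_chart wM ac; have hc' := wc_chart wP ac'.
(* One chart of [N] need not contain all of the image of [f], so the intermediate chart is chosen
   around [f p], and the domain is shrunk to the points that [f] sends into it. *)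
apply: Ck_local => _ [p [dp dgfp] <-].
pose c1 := chart_at (f p); have ac1 : atlas N c1 := wc_atlas wN _.
have hc1 := wc_chart wN ac1.
pose V1 := cdom c1 `&` g @^-1` cdom c'.
have oV1 : open V1.
  apply: openI; first by case: hc1.
  by apply: open_comp; [move=> x _; exact: cg|case: hc'].
pose U1 := cmap c @` (cdom c `&` f @^-1` V1).
have oU1 : open U1.
  by apply: chart_open_image => //; apply: open_comp => // x _; exact: cf.
exists U1.
  by exists p => //; split=> //; split=> //; exact: wc_dom.
have kf : Ck k U1 (cmap c1 \o f \o cinv c).
  have /smooth_onE/(_ k) := sf _ _ ac ac1.
  by apply: Ck_sub => _ [q [dq [d1q _]] <-]; exists q.
have /smooth_onE/(_ k) kg := sg _ _ ac1 ac'.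
have fU x : U1 x -> (cmap c1 @` V1) ((cmap c1 \o f \o cinv c) x).
  by move=> [q [dq V1q] <-]; exists (f q) => //=; rewrite cmapK.
have oV1' : open (cmap c1 @` V1).
  apply: chart_open_image => //.
  by apply: open_comp; [move=> x _; exact: cg|case: hc'].
apply: Ck_eq (Ck_comp oU1 oV1' fU kf kg) => // x [q [dq [d1q _]] <-] /=.
by rewrite !cmapK.
Qed.

Section Rep.
Variables (M N : chartedType R) (f : M -> N) (p : M).
Hypotheses (wM : well_charted M) (wN : well_charted N) (sf : smooth f).

Lemma smooth_diff : differentiable (cmap (chart_at (f p)) \o f \o cinv (chart_at p))
  (cmap (chart_at p) p).
Proof.
have [_ /(_ _ _ (wc_atlas wM p) (wc_atlas wN (f p)))/smooth_onE/(_ 1)] := sf.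
by move=> /Ck_diff; apply; exists p => //; split; exact: wc_dom.
Qed.

Lemma chart_near (V : set M) c : atlas M c -> cdom c p -> open V -> V p ->
  \forall x \near cmap c p, exists q, [/\ cdom c q, V q & x = cmap c q].
Proof.
move=> ac dp oV Vp; have hc := wc_chart wM ac.
apply: filterS (open_nbhs_nbhs (conj (chart_open_image hc oV) _)).
  by move=> _ [q [dq Vq] <-]; exists q.
by exists p.
Qed.

End Rep.

Lemma tangent_comp (M N P : chartedType R) (g : N -> P) (f : M -> N) p v :
  well_charted M -> well_charted N -> well_charted P ->
  smooth g -> smooth f ->
  tangent (fun x => g (f x)) p v = tangent g (f p) (tangent f p v).
Proof.
move=> wM wN wP sg sf; rewrite /tangent.
set c := chart_at p; set c1 := chart_at (f p); set c' := chart_at (g (f p)).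
have dp : cdom c p by exact: wc_dom.
have dfp : cdom c1 (f p) by exact: wc_dom.
have hc1 := wc_chart wN (wc_atlas wN (f p)).
have hc := wc_chart wM (wc_atlas wM p).
have df := smooth_diff p wM wN sf; have dg := smooth_diff (f p) wN wP sg.
have E : (cmap c1 \o f \o cinv c) (cmap c p) = cmap c1 (f p).
  by rewrite /= cmapK.
rewrite -/c1 -/c' -E in dg.
have dgf := differentiable_comp df dg.
have [] := near_eq_diff (g := cmap c' \o (fun x => g (f x)) \o cinv c) _ dgf.
  have oV : open (f @^-1` cdom c1).
    by apply: open_comp; [move=> x _; case: sf => + _; exact|case: hc1].
  apply: filterS (chart_near wM (wc_atlas wM p) dp oV dfp) => _ [q [dq d1q ->]].
  by rewrite /= !cmapK.
by move=> _ ->; rewrite (diff_comp df dg) /= cmapK.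
Qed.

Lemma tangent_id (M : chartedType R) (p : M) v : well_charted M ->
  tangent (fun x : M => x) p v = v.
Proof.
move=> wM; rewrite /tangent; set c := chart_at p.
have dp : cdom c p by exact: wc_dom.
have hc := wc_chart wM (wc_atlas wM p).
have [] := near_eq_diff (f := id) (g := cmap c \o (fun x => x) \o cinv c)
  (x := cmap c p).
- apply: filterS (chart_near wM (wc_atlas wM p) dp openT I) => _ [q [dq _ ->]].
  by rewrite /= cmapK.
- by [].
by move=> _ ->; rewrite diff_val.
Qed.

Lemma smooth_cst (M N : chartedType R) (q : N) : well_charted M ->
  smooth (fun _ : M => q).
Proof.
move=> wM; split=> [|c c' ac ac']; first by move=> x; apply: cvg_cst.
by apply/smooth_onE => k; apply: Ck_cst.
Qed.

Lemma tangent_cst (M N : chartedType R) (q : N) (p : M) v :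
  tangent (fun _ : M => q) p v = 0.
Proof.
rewrite /tangent -[_ \o _ \o _]/(cst (cmap (chart_at q) q)).
by rewrite diff_cst.
Qed.

End Charts.

(** * Products of charted spaces *)

Section Products.
Context {R : realType}.

Lemma row_mx_linearl m n : linear (fun u : 'rV[R]_m => row_mx u 0 : 'rV[R]_(m + n)).
Proof. by move=> a u v; rewrite scale_row_mx add_row_mx scaler0 addr0. Qed.

Lemma row_mx_linearr m n : linear (fun u : 'rV[R]_n => row_mx 0 u : 'rV[R]_(m + n)).
Proof. by move=> a u v; rewrite scale_row_mx add_row_mx scaler0 addr0. Qed.

Lemma row_mx_continuous (T : topologicalType) m n (f : T -> 'rV[R]_m)
    (g : T -> 'rV[R]_n) x : {for x, continuous f} -> {for x, continuous g} ->
  {for x, continuous (fun y => row_mx (f y) (g y))}.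
Proof.
move=> cf cg.
have cl := @linear_rV_continuous _ _ _ (linear_pack (@row_mx_linearl m n)).
have cr := @linear_rV_continuous _ _ _ (linear_pack (@row_mx_linearr m n)).
have clf := continuous_comp cf (cl (f x)).
have crg := continuous_comp cg (cr (g x)).
rewrite (_ : (fun y => _) = (fun y => row_mx (f y) 0 + row_mx 0 (g y))); last first.
  by apply/funext => y; rewrite add_row_mx addr0 add0r.
exact: cvgD clf crg.
Qed.

Lemma chart_prod_cimg (M N : topologicalType) m n (c : chart R M m)
    (c' : chart R N n) x : cimg (chart_prod c c') x <->
  cimg c (lsubmx x) /\ cimg c' (rsubmx x).
Proof.
split=> [[[p q] /= [dp dq] <-]|[[p dp pE] [q dq qE]]].
  by rewrite row_mxKl row_mxKr; split; [exists p|exists q].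
by exists (p, q) => //=; rewrite pE qE hsubmxK.
Qed.

Lemma fst_continuous (M N : topologicalType) : continuous (@fst M N).
Proof. by move=> [x y]; exact: cvg_fst. Qed.

Lemma snd_continuous (M N : topologicalType) : continuous (@snd M N).
Proof. by move=> [x y]; exact: cvg_snd. Qed.

Lemma chart_prodP (M N : topologicalType) m n (c : chart R M m)
  (c' : chart R N n) : is_chart c -> is_chart c' -> is_chart (chart_prod c c').
Proof.
move=> hc hc'.
have [od oi cK cc ci] := hc; have [od' oi' cK' cc' ci'] := hc'.
have odd : open (cdom (chart_prod c c')).
  have o1 : open ((@fst M N) @^-1` cdom c).
    by apply: open_comp => // x _; exact: fst_continuous.
  have o2 : open ((@snd M N) @^-1` cdom c').
    by apply: open_comp => // x _; exact: snd_continuous.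
  exact: openI o1 o2.
have oii : open (cimg (chart_prod c c')).
  have o1 : open ((@lsubmx R 1 m n) @^-1` cimg c).
    by apply: open_comp => // x _; exact: continuous_lsubmx.
  have o2 : open ((@rsubmx R 1 m n) @^-1` cimg c').
    by apply: open_comp => // x _; exact: continuous_rsubmx.
  rewrite (_ : cimg _ = (@lsubmx R 1 m n) @^-1` cimg c `&`
                        (@rsubmx R 1 m n) @^-1` cimg c').
    exact: openI o1 o2.
  by apply/seteqP; split=> x /chart_prod_cimg.
split=> //.
- move=> [p q]; rewrite inE => -[/= dp dq].
  by rewrite row_mxKl row_mxKr !cmapK.
- rewrite continuous_open_subspace// => -[p q]; rewrite inE => -[/= dp dq].
  exact: (row_mx_continuous (f := cmap c \o fst) (g := cmap c' \o snd)
    (continuous_comp (@fst_continuous M N (p, q)) (cmap_continuous hc dp))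
    (continuous_comp (@snd_continuous M N (p, q)) (cmap_continuous hc' dq))).
- rewrite continuous_open_subspace// => x; rewrite inE => /chart_prod_cimg[ix iy].
  rewrite continuous_open_subspace// in ci.
  rewrite continuous_open_subspace// in ci'.
  have cx : {for lsubmx x, continuous (cinv c)} by apply: ci; rewrite inE.
  have cy : {for rsubmx x, continuous (cinv c')} by apply: ci'; rewrite inE.
  have cl := continuous_comp (@continuous_lsubmx _ _ _ _ x) cx.
  have cr := continuous_comp (@continuous_rsubmx _ _ _ _ x) cy.
  exact: (@cvg_pair _ _ _ _ _ _ (nbhs_filter x) _ _ _ _ cl cr).
Qed.

Lemma smooth_rV (M : chartedType R) n (f : M -> 'rV[R]_n) : well_charted M ->
  (forall c k, atlas M c -> Ck k (cimg c) (f \o cinv c)) -> smooth f.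
Proof.
move=> wM kf; split=> [p|c c' ac ->].
  have ac := wc_atlas wM p; have dp := wc_dom wM p.
  have hc := wc_chart wM ac.
  have cfc : {for cmap (chart_at p) p, continuous (f \o cinv (chart_at p))}.
    by apply: (Ck_continuous (kf _ 0 ac)); exists p.
  have : (f \o cinv (chart_at p) \o cmap (chart_at p)) x @[x --> p] -->
      (f \o cinv (chart_at p)) (cmap (chart_at p) p).
    exact: (continuous_comp (cmap_continuous hc dp) cfc).
  rewrite /= cmapK//.
  apply: cvg_trans; apply: near_eq_cvg.
  apply: filterS (open_nbhs_nbhs (conj _ dp)); last by case: hc.
  by move=> q dq /=; rewrite cmapK.
apply/smooth_onE => k; apply: Ck_sub (kf c k ac).
by move=> _ [p [dp _] <-]; exists p.
Qed.

Lemma rV_smooth (M : chartedType R) n (f : M -> 'rV[R]_n) c k : smooth f ->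
  atlas M c -> Ck k (cimg c) (f \o cinv c).
Proof.
move=> [_ sf] ac; have /smooth_onE/(_ k) := sf c _ ac (erefl : atlas 'rV[R]_n _).
by apply: Ck_sub => _ [p dp <-]; exists p.
Qed.

Section Pair.
Variables (M N P : chartedType R).
Hypotheses (wM : well_charted M) (wN : well_charted N) (wP : well_charted P).

Lemma smooth_pair (f : M -> N) (g : M -> P) : smooth f -> smooth g ->
  smooth (fun x => (f x, g x)).
Proof.
move=> [cf sf] [cg sg]; split.
  by move=> x; apply: (@cvg_pair _ _ _ _ _ _ _ _ _ _ _ (cf x) (cg x)).
move=> c _ ac [c1 [c2 [ac1 ac2 ->]]]; apply/smooth_onE => k.
have hc := wc_chart wM ac.
have [od1 _ _ _ _] := wc_chart wN ac1; have [od2 _ _ _ _] := wc_chart wP ac2.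
have /smooth_onE/(_ k) kf := sf _ _ ac ac1.
have /smooth_onE/(_ k) kg := sg _ _ ac ac2.
apply: Ck_row_mx.
- apply: chart_open_image => //.
  have o1 : open (f @^-1` cdom c1) by apply: open_comp => // x _; exact: cf.
  have o2 : open (g @^-1` cdom c2) by apply: open_comp => // x _; exact: cg.
  exact: openI o1 o2.
- by apply: Ck_sub kf => _ [p [dp [d1p _]] <-]; exists p.
- by apply: Ck_sub kg => _ [p [dp [_ d2p]] <-]; exists p.
Qed.

Lemma diff_row_mx m n p (f : 'rV[R]_p -> 'rV[R]_m) (g : 'rV[R]_p -> 'rV[R]_n) x v :
  differentiable f x -> differentiable g x ->
  'd (fun y => row_mx (f y) (g y)) x v = row_mx ('d f x v) ('d g x v).
Proof.
move=> df dg.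
set Ll := linear_pack (@row_mx_linearl m n).
set Lr := linear_pack (@row_mx_linearr m n).
have cl : continuous Ll by exact: linear_rV_continuous.
have cr : continuous Lr by exact: linear_rV_continuous.
have dl := linear_differentiable (f x) cl.
have dr := linear_differentiable (g x) cr.
rewrite (_ : (fun y => _) = (Ll \o f) + (Lr \o g)); last first.
  by apply/funext => y; rewrite [RHS]add_row_mx addr0 add0r.
have el : 'd (Ll \o f) x v = row_mx ('d f x v) 0.
  rewrite (diff_comp df dl).
  exact: (congr1 (@^~ ('d f x v)) (diff_lin (f x) cl)).
have er : 'd (Lr \o g) x v = row_mx 0 ('d g x v).
  rewrite (diff_comp dg dr).
  exact: (congr1 (@^~ ('d g x v)) (diff_lin (g x) cr)).
rewrite (diffD (differentiable_comp df dl) (differentiable_comp dg dr)).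
transitivity (row_mx ('d f x v) 0 + row_mx 0 ('d g x v) : 'rV[R]_(m + n)).
  exact: (congr2 +%R el er).
by rewrite add_row_mx addr0 add0r.
Qed.

Lemma tangent_pair (f : M -> N) (g : M -> P) p v : smooth f -> smooth g ->
  tangent (fun x => (f x, g x)) p v = row_mx (tangent f p v) (tangent g p v).
Proof.
move=> sf sg.
exact: diff_row_mx _ (smooth_diff p wM wN sf) (smooth_diff p wM wP sg).
Qed.

End Pair.

Lemma smooth_fst (M N : chartedType R) : well_charted M -> well_charted N ->
  smooth (@fst M N).
Proof.
move=> wM wN; split=> [|_ c [c1 [c2 [ac1 ac2 ->]]] ac]; first exact: fst_continuous.
have hc1 := wc_chart wM ac1; have hc2 := wc_chart wN ac2.
have [od _ _ _ _] := wc_chart wM ac.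
(* The target chart [c] may differ from the first factor [c1] of the source chart: in coordinates
   the projection is [lsubmx] followed by the transition map, which is the identity of [M] read from
   [c1] to [c]. *)
have [_ /(_ _ _ ac1 ac)/smooth_onE kid] := wc_id wM.
apply/smooth_onE => k.
have oU : open (cmap (chart_prod c1 c2) @`
    (cdom (chart_prod c1 c2) `&` fst @^-1` cdom c)).
  apply: (chart_open_image (chart_prodP hc1 hc2)).
  by apply: open_comp => // x _; exact: fst_continuous.
have oU' : open (cmap c1 @` (cdom c1 `&` cdom c)) by exact: chart_open_image.
apply: (Ck_comp (f := lsubmx) oU oU' _ _ (kid k)).
  by move=> _ [[p q] /= [[dp dq] d1p] <-]; rewrite row_mxKl; exists p.
by apply: Ck_lin => //; apply: linear_rV_continuous.
Qed.

Lemma smooth_snd (M N : chartedType R) : well_charted M -> well_charted N ->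
  smooth (@snd M N).
Proof.
move=> wM wN; split=> [|_ c [c1 [c2 [ac1 ac2 ->]]] ac]; first exact: snd_continuous.
have hc1 := wc_chart wM ac1; have hc2 := wc_chart wN ac2.
have [od _ _ _ _] := wc_chart wN ac.
have [_ /(_ _ _ ac2 ac)/smooth_onE kid] := wc_id wN.
apply/smooth_onE => k.
have oU : open (cmap (chart_prod c1 c2) @`
    (cdom (chart_prod c1 c2) `&` snd @^-1` cdom c)).
  apply: (chart_open_image (chart_prodP hc1 hc2)).
  by apply: open_comp => // x _; exact: snd_continuous.
have oU' : open (cmap c2 @` (cdom c2 `&` cdom c)) by exact: chart_open_image.
apply: (Ck_comp (f := rsubmx) oU oU' _ _ (kid k)).
  by move=> _ [[p q] /= [[dp dq] d1p] <-]; rewrite row_mxKr; exists q.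
by apply: Ck_lin => //; apply: linear_rV_continuous.
Qed.

Lemma prod_well_charted (M N : chartedType R) :
  well_charted M -> well_charted N -> well_charted (M * N)%type.
Proof.
move=> wM wN.
have wc : forall c, atlas (M * N)%type c -> is_chart c.
  move=> _ [c1 [c2 [ac1 ac2 ->]]]; apply: chart_prodP.
    exact: wc_chart ac1.
  exact: wc_chart ac2.
have wa : forall p : M * N, atlas (M * N)%type (chart_at p).
  by move=> p; exists (chart_at p.1), (chart_at p.2); split=> //; exact: wc_atlas.
have wd : forall p : M * N, cdom (chart_at p) p by move=> p; split; exact: wc_dom.
split=> //.
have [cf sf] := smooth_fst wM wN; have [cg sg] := smooth_snd wM wN.
split; first by move=> x; apply: cvg_id.
move=> c _ ac [c1 [c2 [ac1 ac2 ->]]]; apply/smooth_onE => k.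
have [od1 _ _ _ _] := wc_chart wM ac1; have [od2 _ _ _ _] := wc_chart wN ac2.
have /smooth_onE/(_ k) kf := sf _ _ ac ac1.
have /smooth_onE/(_ k) kg := sg _ _ ac ac2.
apply: Ck_row_mx.
- apply: (chart_open_image (wc _ ac)).
  by case: (chart_prodP (wc_chart wM ac1) (wc_chart wN ac2)).
- by apply: Ck_sub kf => _ [p [dp [d1p _]] <-]; exists p.
- by apply: Ck_sub kg => _ [p [dp [_ d2p]] <-]; exists p.
Qed.

End Products.

(** * Partial tangent maps and their exchange *)

Section Partial.
Context {R : realType}.

Lemma smooth_linear m n (L : {linear 'rV[R]_m -> 'rV[R]_n}) : smooth L.
Proof.
apply: (smooth_rV (rV_well_charted m)) => c k ->; rewrite /cimg /= image_id.
by apply: Ck_lin; [exact: openT|exact: linear_rV_continuous].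
Qed.

Lemma tangent_lin m n (L : {linear 'rV[R]_m -> 'rV[R]_n}) x v :
  tangent L x v = L v.
Proof.
rewrite /tangent -[_ \o _ \o _]/(L : _ -> _) diff_lin//.
exact: linear_rV_continuous.
Qed.

Lemma smooth_rV_sum (M : chartedType R) n (I : Type) (r : seq I)
    (f : I -> M -> 'rV[R]_n) : well_charted M ->
  (forall i, smooth (f i)) -> smooth (fun x => \sum_(i <- r) f i x).
Proof.
move=> wM sf; apply: smooth_rV => // c k ac.
have oc : open (cimg c) by case: (wc_chart wM ac).
rewrite -[_ \o _]/(fun x => \sum_(i <- r) f i (cinv c x)).
by apply: Ck_sum => // i; exact: (rV_smooth k (sf i) ac).
Qed.

Lemma smooth_rV_add (M : chartedType R) n (f h : M -> 'rV[R]_n) :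
  well_charted M -> smooth f -> smooth h -> smooth (fun x => f x + h x).
Proof.
move=> wM sf sh; apply: smooth_rV => // c k ac.
have oc : open (cimg c) by case: (wc_chart wM ac).
exact: (Ck_add oc (rV_smooth k sf ac) (rV_smooth k sh ac)).
Qed.

Lemma tangent_add (M : chartedType R) n (f g : M -> 'rV[R]_n) p v :
  well_charted M -> smooth f -> smooth g ->
  tangent (fun x => f x + g x) p v = tangent f p v + tangent g p v.
Proof.
move=> wM sf sg.
have wr := rV_well_charted (R := R) n.
have dE (h : M -> 'rV[R]_n) : tangent h p v =
  'd (h \o cinv (chart_at p)) (cmap (chart_at p) p) v by [].
have df : differentiable (f \o cinv (chart_at p)) (cmap (chart_at p) p).
  exact: smooth_diff p wM wr sf.
have dg : differentiable (g \o cinv (chart_at p)) (cmap (chart_at p) p).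
  exact: smooth_diff p wM wr sg.
rewrite !{}dE (_ : _ \o _ = (f \o cinv (chart_at p)) + (g \o cinv (chart_at p)))//.
exact: (congr1 (@^~ v) (diffD df dg)).
Qed.

Variables (M N P : chartedType R).
Hypotheses (wM : well_charted M) (wN : well_charted N) (wP : well_charted P).

Let wMN := prod_well_charted wM wN.

Lemma smooth_slicer (Phi : M * N -> P) p : smooth Phi ->
  smooth (fun y => Phi (p, y)).
Proof.
move=> sPhi; apply: (smooth_comp wN wMN wP sPhi).
by apply: smooth_pair => //; [exact: smooth_cst|exact: wc_id].
Qed.

Lemma tangent_slicel (Phi : M * N -> P) p q u : smooth Phi ->
  tangent (fun x => Phi (x, q)) p u = tangent Phi (p, q) (row_mx u 0).
Proof.
move=> sPhi.
have s1 : smooth (fun x : M => (x, q)).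
  by apply: smooth_pair => //; [exact: wc_id|exact: smooth_cst].
rewrite (tangent_comp p u wM wMN wP sPhi s1); congr (tangent Phi _ _).
rewrite (tangent_pair wM wM wN p u (wc_id wM) (smooth_cst q wM)).
by rewrite tangent_id// tangent_cst.
Qed.

Lemma tangent_slicer (Phi : M * N -> P) p q v : smooth Phi ->
  tangent (fun y => Phi (p, y)) q v = tangent Phi (p, q) (row_mx 0 v).
Proof.
move=> sPhi.
have s1 : smooth (fun y : N => (p, y)).
  by apply: smooth_pair => //; [exact: smooth_cst|exact: wc_id].
rewrite (tangent_comp q v wN wMN wP sPhi s1); congr (tangent Phi _ _).
rewrite (tangent_pair wN wM wN q v (smooth_cst p wN) (wc_id wN)).
by rewrite tangent_id// tangent_cst.
Qed.

(** [row_mx u v] is the sum of [row_mx u 0] and [row_mx 0 v], the tangent vectors of the two slices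
    through [(p, q)]. *)
Lemma tangent_prod (Phi : M * N -> P) p q u v : smooth Phi ->
  tangent Phi (p, q) (row_mx u v) =
  tangent (fun x => Phi (x, q)) p u + tangent (fun y => Phi (p, y)) q v.
Proof.
move=> sPhi; rewrite tangent_slicel// tangent_slicer//.
rewrite -[RHS]linearD; congr (tangent Phi _ _).
by rewrite add_row_mx addr0 add0r.
Qed.

Section Second.
Variables (Phi : M * N -> P) (x0 : M) (y0 : N) (p0 : P).
Hypothesis sPhi : smooth Phi.

(** The target chart is fixed at [p0], while the source charts vary: the parameter of a family may
    run through any chart, and the variable of the inner tangent map is read in its preferred
    one. *)
Let rep (c : chart R M (mdim M)) (c' : chart R N (mdim N)) :
    'rV[R]_(mdim M + mdim N) -> 'rV[R]_(mdim P) :=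
  cmap (chart_at p0) \o Phi \o cinv (chart_prod c c').
Let U (c : chart R M (mdim M)) (c' : chart R N (mdim N)) :=
  cmap (chart_prod c c') @`
  (cdom (chart_prod c c') `&` Phi @^-1` cdom (chart_at p0)).

Lemma rep_open c c' : atlas M c -> atlas N c' -> open (U c c').
Proof.
move=> ac ac'; apply: chart_open_image.
  by apply: chart_prodP; [exact: wc_chart ac|exact: wc_chart ac'].
apply: open_comp; first by move=> x _; case: sPhi => + _; exact.
by case: (wc_chart wP (wc_atlas wP p0)).
Qed.

Lemma rep_Ck c c' k : atlas M c -> atlas N c' -> Ck k (U c c') (rep c c').
Proof.
move=> ac ac'; case: sPhi => _ /(_ (chart_prod c c') _ _ (wc_atlas wP p0)).
by move=> /(_ _)/smooth_onE; apply; exists c, c'.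
Qed.

Lemma rep_dom c c' p q : cdom c p -> cdom c' q -> Phi (p, q) = p0 ->
  U c c' (row_mx (cmap c p) (cmap c' q)).
Proof.
by move=> dp dq pq; exists (p, q) => //=; split=> //=; rewrite pq; exact: wc_dom.
Qed.

Lemma diff_row_mxl m n (f : 'rV[R]_(m + n) -> 'rV[R]_(mdim P)) x y u :
  differentiable f (row_mx x y) ->
  differentiable (fun z => f (row_mx z y)) x /\
  'd (fun z => f (row_mx z y)) x u = 'd f (row_mx x y) (row_mx u 0).
Proof.
move=> df.
have k1 : Ck 1 setT (fun z : 'rV[R]_m => row_mx z y).
  by apply: Ck_row_mx; [exact: openT|exact/Ck_id/openT|exact: Ck_cst].
have dr := Ck_diff k1 (I : setT x).
split; first exact: (differentiable_comp dr df).
rewrite (diff_comp dr df) /= diff_row_mx//.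
by rewrite !diff_val.
Qed.

Lemma diff_row_mxr m n (f : 'rV[R]_(m + n) -> 'rV[R]_(mdim P)) x y u :
  differentiable f (row_mx x y) ->
  differentiable (fun z => f (row_mx x z)) y /\
  'd (fun z => f (row_mx x z)) y u = 'd f (row_mx x y) (row_mx 0 u).
Proof.
move=> df.
have k1 : Ck 1 setT (fun z : 'rV[R]_n => row_mx x z).
  by apply: Ck_row_mx; [exact: openT|exact: Ck_cst|exact/Ck_id/openT].
have dr := Ck_diff k1 (I : setT y).
split; first exact: (differentiable_comp dr df).
rewrite (diff_comp dr df) /= diff_row_mx//.
by rewrite !diff_val.
Qed.

Lemma tangent_rep_r c v : atlas M c -> (forall x, Phi (x, y0) = p0) ->
  forall x, cimg c x -> tangent (fun y => Phi (cinv c x, y)) y0 v =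
    'd (rep c (chart_at y0)) (row_mx x (cmap (chart_at y0) y0)) (row_mx 0 v).
Proof.
move=> ac Phi0 x ix.
have [dx xE] := cinvP (wc_chart wM ac) ix.
have dU := rep_dom dx (wc_dom wN y0) (Phi0 _); rewrite xE in dU.
have [_ <-] := diff_row_mxr v (Ck_diff (rep_Ck 1 ac (wc_atlas wN y0)) dU).
rewrite /tangent Phi0.
have -> // : cmap (chart_at p0) \o (fun y => Phi (cinv c x, y)) \o
    cinv (chart_at y0) = fun z => rep c (chart_at y0) (row_mx x z).
by apply/funext => z; rewrite /rep /= row_mxKl row_mxKr.
Qed.

Lemma tangent_rep_l c' u : atlas N c' -> (forall y, Phi (x0, y) = p0) ->
  forall y, cimg c' y -> tangent (fun x => Phi (x, cinv c' y)) x0 u =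
    'd (rep (chart_at x0) c') (row_mx (cmap (chart_at x0) x0) y) (row_mx u 0).
Proof.
move=> ac Phi0 y iy.
have [dy yE] := cinvP (wc_chart wN ac) iy.
have dU := rep_dom (wc_dom wM x0) dy (Phi0 _); rewrite yE in dU.
have [_ <-] := diff_row_mxl u (Ck_diff (rep_Ck 1 (wc_atlas wM x0) ac) dU).
rewrite /tangent Phi0.
have -> // : cmap (chart_at p0) \o (fun x => Phi (x, cinv c' y)) \o
    cinv (chart_at x0) = fun z => rep (chart_at x0) c' (row_mx z y).
by apply/funext => z; rewrite /rep /= row_mxKl row_mxKr.
Qed.

(** As [Phi (x, y0)] is constant, the chart at [p0] serves for all [x], and the inner tangent map
    becomes a directional derivative of the single smooth function [rep], restricted to a slice. *)
Lemma smooth_tangent_param v : (forall x, Phi (x, y0) = p0) ->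
  smooth (fun x => tangent (fun y => Phi (x, y)) y0 v : 'rV[R]_(mdim P)).
Proof.
move=> Phi0; apply: (smooth_rV wM) => c k ac.
have oc : open (cimg c) by case: (wc_chart wM ac).
have ay0 := wc_atlas wN y0.
pose b := cmap (chart_at y0) y0.
have [_ /(_ (row_mx 0 v)) kd] := rep_Ck k.+1 ac ay0.
have kr : Ck k (cimg c) (fun x => row_mx x b).
  by apply: Ck_row_mx => //; [exact: Ck_id|exact: Ck_cst].
have rU x : cimg c x -> U c (chart_at y0) (row_mx x b).
  move=> ix; have [dx xE] := cinvP (wc_chart wM ac) ix.
  by have := rep_dom dx (wc_dom wN y0) (Phi0 _); rewrite xE.
apply: Ck_eq (Ck_comp oc (rep_open ac ay0) rU kr kd) => // x ix.
by rewrite /= tangent_rep_r.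
Qed.

(** Constancy on both axes puts both inner tangent vectors in the tangent space at [p0]. Both sides
    are then second derivatives of the same [rep] at the same point, in directions [(u, 0)] and
    [(0, v)], and Schwarz applies. *)
Lemma tangent_mixed u v : (forall x, Phi (x, y0) = p0) ->
  (forall y, Phi (x0, y) = p0) ->
  tangent (fun x => tangent (fun y => Phi (x, y)) y0 v : 'rV[R]_(mdim P)) x0 u =
  tangent (fun y => tangent (fun x => Phi (x, y)) x0 u : 'rV[R]_(mdim P)) y0 v.
Proof.
move=> Phir Phil.
pose c := chart_at x0; pose c' := chart_at y0.
have ac : atlas M c by exact: wc_atlas.
have ac' : atlas N c' by exact: wc_atlas.
have dx : cdom c x0 by exact: wc_dom.
have dy : cdom c' y0 by exact: wc_dom.
have oc : open (cimg c) by case: (wc_chart wM ac).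
have oc' : open (cimg c') by case: (wc_chart wN ac').
pose a := cmap c x0; pose b := cmap c' y0.
have Uab : U c c' (row_mx a b) by apply: rep_dom.
have k2 := rep_Ck 2 ac ac'.
have dd w : differentiable (fun z => 'd (rep c c') z w) (row_mx a b).
  by case: k2 => _ /(_ w)[+ _]; apply.
have [dl dlE] := diff_row_mxl u (dd (row_mx 0 v)).
have [dr drE] := diff_row_mxr v (dd (row_mx u 0)).
have [] := near_eq_diff
  (g := fun x => tangent (fun y => Phi (cinv c x, y)) y0 v) _ dl.
  apply: filterS (open_nbhs_nbhs (conj oc _)); last by exists x0.
  by move=> x ix; exact: esym (tangent_rep_r v ac Phir ix).
have [] := near_eq_diff
  (g := fun y => tangent (fun x => Phi (x, cinv c' y)) x0 u) _ dr.
  apply: filterS (open_nbhs_nbhs (conj oc' _)); last by exists y0.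
  by move=> y iy; exact: esym (tangent_rep_l u ac' Phil iy).
move=> _ er _ el.
transitivity ('d (fun z => 'd (rep c c') z (row_mx 0 v)) (row_mx a b) (row_mx u 0)).
  by rewrite -dlE -el.
rewrite (diff2_sym _ _ (rep_open ac ac') Uab k2).
by rewrite -drE -er.
Qed.

End Second.
End Partial.

(** * Lie groups and crossed modules *)

Section LieGroups.
Context {R : realType}.
Implicit Types G H : lieGroupType R.

Lemma lie_wc G : well_charted G.
Proof. exact: manifold_well_charted. Qed.

Section Combinators.
Variables (M : chartedType R) (G : lieGroupType R).
Hypothesis wM : well_charted M.
Let wG := lie_wc G.
Let wGG := prod_well_charted wG wG.

Lemma smooth_mulg (f g : M -> G) : smooth f -> smooth g ->
  smooth (fun x => (f x * g x)%g).
Proof.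
move=> sf sg.
have sm : smooth (fun p : G * G => (p.1 * p.2)%g) := lie_mul_smooth.
exact: smooth_comp wM wGG wG sm (smooth_pair wM wG wG sf sg).
Qed.

Lemma smooth_invg (f : M -> G) : smooth f -> smooth (fun x => (f x)^-1%g).
Proof. exact: smooth_comp wM wG wG lie_inv_smooth. Qed.

(** Left and right multiplication by 1 are the identity, so the differential of the product at
    [(1, 1)] is addition. *)
Lemma tangent_mulg (f g : M -> G) p v : smooth f -> smooth g ->
  f p = 1%g -> g p = 1%g ->
  tangent (fun x => (f x * g x)%g) p v = tangent f p v + tangent g p v.
Proof.
move=> sf sg fp gp.
have sm : smooth (fun p : G * G => (p.1 * p.2)%g) := lie_mul_smooth.
have := tangent_comp p v wM wGG wG sm (smooth_pair wM wG wG sf sg).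
rewrite (tangent_pair wM wG wG p v sf sg) fp gp => /= ->.
rewrite (tangent_prod wG wG wG 1%g 1%g _ _ sm) /=.
under eq_fun do rewrite mulg1.
under [X in _ + tangent X _ _]eq_fun do rewrite mul1g.
by congr (_ + _); exact: tangent_id.
Qed.

Lemma tangent_invg (f : M -> G) p v : smooth f -> f p = 1%g ->
  tangent (fun x => (f x)^-1%g) p v = - tangent f p v.
Proof.
move=> sf fp; apply/eqP; rewrite -addr_eq0 addrC; apply/eqP.
rewrite -tangent_mulg//; [|exact: smooth_invg|by rewrite fp invg1].
under eq_fun do rewrite mulgV.
by rewrite tangent_cst.
Qed.

End Combinators.

Lemma lie_hom1 G H (f : G -> H) : {morph f : x y / (x * y)%g} -> f 1%g = 1%g.
Proof. by move=> fM; apply: (mulgI (f 1%g)); rewrite -fM !mulg1. Qed.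

Lemma lie_homV G H (f : G -> H) x : {morph f : x y / (x * y)%g} ->
  f (x^-1)%g = (f x)^-1%g.
Proof.
by move=> fM; apply: (mulgI (f x)); rewrite -fM !mulgV lie_hom1.
Qed.

Lemma tangent_comp1 (M N P : chartedType R) (g : N -> P) (f : M -> N) p q v :
  well_charted M -> well_charted N -> well_charted P ->
  smooth g -> smooth f -> f p = q ->
  tangent (fun x => g (f x)) p v = tangent g q (tangent f p v).
Proof. by move=> wM wN wP sg sf <-; exact: tangent_comp. Qed.

Lemma conj_smooth G : smooth (fun p : G * G => (p.1 * p.2 * p.1^-1)%g).
Proof.
have wGG := prod_well_charted (lie_wc G) (lie_wc G).
have s1 := smooth_fst (lie_wc G) (lie_wc G).
have s2 := smooth_snd (lie_wc G) (lie_wc G).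
by apply: smooth_mulg => //; [apply: smooth_mulg|apply: smooth_invg].
Qed.

Lemma Ad_smooth G (v : lie G) : smooth (fun g : G => Ad g v : 'rV[R]__).
Proof.
have wG := lie_wc G.
apply: (smooth_tangent_param (p0 := 1%g) wG wG wG (conj_smooth G)).
by move=> x /=; rewrite mulg1 mulgV.
Qed.

Lemma Ad_hom G H (f : G -> H) g v : smooth f -> {morph f : x y / (x * y)%g} ->
  tangent f 1%g (Ad g v) = Ad (f g) (tangent f 1%g v).
Proof.
move=> sf fM; have wG := lie_wc G; have wH := lie_wc H.
have sc := smooth_slicer wG wG wG g (conj_smooth G).
have sc' := smooth_slicer wH wH wH (f g) (conj_smooth H).
rewrite /Ad -(tangent_comp1 v wG wG wH sf sc) /= ?mulg1 ?mulgV//.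
rewrite -(tangent_comp1 v wG wH wH sc' sf (lie_hom1 fM)) /=.
by under eq_fun do rewrite !fM (lie_homV _ fM).
Qed.

(** At the fixed point [q] the tangent map is a linear map of model spaces, hence commutes with
    differentiation in a parameter. *)
Lemma tangent_tangent (M : chartedType R) (N P : chartedType R)
    (h : N -> P) q (f : M -> 'rV[R]_(mdim N)) p u :
  well_charted M -> smooth f ->
  tangent (fun x => tangent h q (f x) : 'rV[R]__) p u = tangent h q (tangent f p u).
Proof.
move=> wM sf; have wr := @rV_well_charted R.
pose L := 'd (cmap (chart_at (h q)) \o h \o cinv (chart_at q))
             (cmap (chart_at q) q).
rewrite -[LHS]/(tangent (fun x => L (f x)) p u).
rewrite (tangent_comp p u wM (wr _) (wr _) (smooth_linear L) sf).
exact: tangent_lin.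
Qed.

Lemma tangent_bracket G H (f : G -> H) u v : smooth f ->
  {morph f : x y / (x * y)%g} ->
  tangent f 1%g (lie_bracket u v) =
  lie_bracket (tangent f 1%g u) (tangent f 1%g v).
Proof.
move=> sf fM; have wG := lie_wc G; have wH := lie_wc H.
have wr := @rV_well_charted R.
rewrite -(tangent_tangent f 1%g 1%g u wG (Ad_smooth v)).
under eq_fun do rewrite Ad_hom//.
exact: (tangent_comp1 u wG wH (wr _) (Ad_smooth (tangent f 1%g v)) sf
  (lie_hom1 fM)).
Qed.

(** This separates the contributions of a variable occurring in two roles, as [g] does in [chi g]
    and in the action of [g]. *)
Lemma tangent_diag (M : chartedType R) n (E : M * M -> 'rV[R]_n) p u :
  well_charted M -> smooth E ->
  tangent (fun x => E (x, x)) p u =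
  tangent (fun x => E (x, p)) p u + tangent (fun x => E (p, x)) p u.
Proof.
move=> wM sE; have wr := rV_well_charted (R := R) n.
have wMM := prod_well_charted wM wM.
have sd : smooth (fun x : M => (x, x)).
  by apply: smooth_pair => //; exact: wc_id.
rewrite (tangent_comp p u wM wMM wr sE sd).
rewrite (tangent_pair wM wM wM p u (wc_id wM) (wc_id wM)).
rewrite (tangent_prod wM wM wr p p _ _ sE).
by congr (_ + _); congr (tangent _ _ _); exact: tangent_id.
Qed.

End LieGroups.

Section CrossedModules.
Context {R : realType}.
Variable G : lieXMod R.
Notation G0 := (xm0 G).
Notation G1 := (xm1 G).
Let w0 := lie_wc G0.
Let w1 := lie_wc G1.
Let w00 := prod_well_charted w0 w0.
Let w01 := prod_well_charted w0 w1.
Let wr := @rV_well_charted R.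

Lemma xmact1 (g : G0) : xmact g (1%g : G1) = 1%g.
Proof. exact: lie_hom1 (@xmact_hom _ G g). Qed.

Lemma smooth_xmact (M : chartedType R) (f : M -> G0) (g : M -> G1) :
  well_charted M -> smooth f -> smooth g -> smooth (fun x => xmact (f x) (g x)).
Proof.
move=> wM sf sg.
exact: smooth_comp wM w01 w1 (@xmact_smooth _ G) (smooth_pair wM w0 w1 sf sg).
Qed.

Lemma smooth_xmactr (g : G0) : smooth (@xmact _ G g).
Proof. exact: (smooth_slicer w0 w1 w1 g (@xmact_smooth _ G)). Qed.

Lemma smooth_tangent_xmact (a : lie G1) :
  smooth (fun g : G0 => tangent (xmact g) 1%g a : 'rV[R]__).
Proof.
apply: (smooth_tangent_param (p0 := 1%g) w0 w1 w1 (@xmact_smooth _ G)).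
by move=> x; exact: xmact1.
Qed.

(** The infinitesimal action, in the form used by [diff_act]: the inner derivative is in the element
    acted upon, the outer one in the acting element. *)
Definition lie_act (x : lie G0) (a : lie G1) : lie G1 :=
  tangent (fun k : G0 => tangent (xmact k) 1%g a) 1%g x.

Lemma tangent_lie_act (F0 : G0 -> G0) (F1 : G1 -> G1) x a :
  smooth F0 -> {morph F0 : x y / (x * y)%g} ->
  smooth F1 -> {morph F1 : x y / (x * y)%g} ->
  (forall g h, F1 (xmact g h) = xmact (F0 g) (F1 h)) ->
  tangent F1 1%g (lie_act x a) =
  lie_act (tangent F0 1%g x) (tangent F1 1%g a).
Proof.
move=> s0 F0M s1 F1M Fact.
rewrite -(tangent_tangent F1 1%g 1%g x w0 (smooth_tangent_xmact a)).
have -> : (fun k : G0 => tangent F1 1%g (tangent (xmact k) 1%g a)) =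
    (fun k : G0 => tangent (xmact (F0 k)) 1%g (tangent F1 1%g a)).
  apply/funext => k.
  have e1 := tangent_comp1 a w1 w1 w1 s1 (smooth_xmactr k) (xmact1 k).
  have e2 := tangent_comp1 a w1 w1 w1 (smooth_xmactr (F0 k)) s1 (lie_hom1 F1M).
  by rewrite -e1 -e2; congr (tangent _ _ a); apply/funext => h; exact: Fact.
exact: (tangent_comp1 x w0 w0 (wr _) (smooth_tangent_xmact (tangent F1 1%g a))
  s0 (lie_hom1 F0M)).
Qed.

Section Derivation.
Variable chi : G0 -> G1.
Hypotheses (schi : smooth chi)
  (chiM : forall a b, chi (a * b)%g = (chi a * xmact a (chi b))%g).

Lemma derivation1 : chi 1%g = 1%g.
Proof.
by apply: (mulgI (chi 1%g)); rewrite -[X in (_ * X)%g]xmact_1 -chiM !mulg1.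
Qed.

Lemma derivationV g : xmact g (chi g^-1%g) = (chi g)^-1%g.
Proof. by apply: (mulgI (chi g)); rewrite -chiM !mulgV derivation1. Qed.

(* The two factors are trivial for [h = 1], so that the derivative in [h] of
   their product is the sum of their derivatives. *)
Lemma derivation_conj g h : chi (g * h * g^-1)%g =
  ((chi g * xmact g (chi h) * (chi g)^-1) *
   (chi g * xmact (g * h * g^-1) (chi g)^-1))%g.
Proof.
by rewrite mulgA mulgVK -derivationV -xmact_mul mulgVK chiM chiM.
Qed.

Section Factors.
Let tau := tangent chi 1%g.
Let w000 := prod_well_charted w00 w0.
Let s1 : smooth (fun p : (G0 * G0) * G0 => p.1.1) :=
  smooth_comp w000 w00 w0 (smooth_fst w0 w0) (smooth_fst w00 w0).
Let s2 : smooth (fun p : (G0 * G0) * G0 => p.1.2) :=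
  smooth_comp w000 w00 w0 (smooth_snd w0 w0) (smooth_fst w00 w0).
Let s3 : smooth (fun p : (G0 * G0) * G0 => p.2) := smooth_snd w00 w0.
Let sc (M : chartedType R) (f : M -> G0) : well_charted M -> smooth f ->
  smooth (fun x => chi (f x)) := fun wM => smooth_comp wM w0 w1 schi.

(** The two roles of [g] are the independent variables [p.1.1], inside [chi], and [p.1.2], which
    acts; [p.2] is [h]. *)
Lemma smooth_conj_factor :
  smooth (fun p : (G0 * G0) * G0 =>
    chi p.1.1 * xmact p.1.2 (chi p.2) * (chi p.1.1)^-1)%g.
Proof.
apply: smooth_mulg => //; last by apply: smooth_invg => //; apply: sc.
apply: smooth_mulg => //; first exact: sc.
by apply: smooth_xmact => //; apply: sc.
Qed.

Lemma smooth_act_factor :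
  smooth (fun p : (G0 * G0) * G0 =>
    chi p.1.1 * xmact (p.1.2 * p.2 * p.1.2^-1) (chi p.1.1)^-1)%g.
Proof.
apply: smooth_mulg => //; first exact: sc.
apply: smooth_xmact => //; last by apply: smooth_invg => //; apply: sc.
apply: smooth_mulg => //; last exact: smooth_invg.
exact: smooth_mulg.
Qed.

(** With the acting [g] set to 1 the inner tangent map is [Ad (chi g) (tau v)], whose derivative is
    a bracket; with the [g] inside [chi] set to 1 it is the action of [g] on [tau v]. *)
Lemma tangent_conj_factor u v :
  tangent (fun g =>
      tangent (fun h => chi g * xmact g (chi h) * (chi g)^-1)%g 1%g v
      : 'rV[R]__) 1%g u = lie_bracket (tau u) (tau v) + lie_act u (tau v).
Proof.
pose E (p : G0 * G0) : 'rV[R]_(mdim G1) :=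
  tangent (fun h => chi p.1 * xmact p.2 (chi h) * (chi p.1)^-1)%g 1%g v.
have sE : smooth E.
  apply: (smooth_tangent_param (p0 := 1%g) w00 w0 w1 smooth_conj_factor).
  by move=> x /=; rewrite derivation1 xmact1 mulg1 mulgV.
have D := tangent_diag 1%g u w0 sE.
have e1 : tangent (fun g => E (g, 1%g)) 1%g u = lie_bracket (tau u) (tau v).
  have -> : (fun g => E (g, 1%g)) = (fun g => Ad (chi g) (tau v)).
    apply/funext => g; rewrite /E /Ad /=.
    rewrite -(tangent_comp1 v w0 w1 w1
      (smooth_slicer w1 w1 w1 (chi g) (conj_smooth G1)) schi derivation1).
    by congr (tangent _ _ v); apply/funext => h /=; rewrite xmact_1.
  exact: (tangent_comp1 u w0 w1 (wr _) (Ad_smooth (tau v)) schi derivation1).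
have e2 : tangent (fun g => E (1%g, g)) 1%g u = lie_act u (tau v).
  have -> // : (fun g => E (1%g, g)) = (fun g => tangent (xmact g) 1%g (tau v)).
  apply/funext => g; rewrite /E /=.
  rewrite -(tangent_comp1 v w0 w1 w1 (smooth_xmactr g) schi derivation1).
  congr (tangent _ _ v); apply/funext => h /=.
  by rewrite derivation1 invg1 mulg1 mul1g.
exact: (etrans D (congr2 +%R e1 e2)).
Qed.

(** Only the [g] inside [chi] contributes: with [chi g] replaced by 1 the factor is constant. What
    remains is [m (k, l)] at [k = chi g] and [l = h], and [m] is trivial on both axes, as the
    exchange of derivatives requires. *)
Lemma tangent_act_factor u v :
  tangent (fun g =>
      tangent (fun h => chi g * xmact (g * h * g^-1) (chi g)^-1)%g 1%g v
      : 'rV[R]__) 1%g u = - lie_act v (tau u).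
Proof.
pose E (p : G0 * G0) : 'rV[R]_(mdim G1) :=
  tangent (fun h => chi p.1 * xmact (p.2 * h * p.2^-1) (chi p.1)^-1)%g 1%g v.
have sE : smooth E.
  apply: (smooth_tangent_param (p0 := 1%g) w00 w0 w1 smooth_act_factor).
  by move=> x /=; rewrite mulg1 mulgV xmact_1 mulgV.
pose m (p : G1 * G0) := (p.1 * xmact p.2 p.1^-1)%g.
have w10 := prod_well_charted w1 w0.
have sm1 := smooth_fst w1 w0; have sm2 := smooth_snd w1 w0.
have sm : smooth m.
  by apply: smooth_mulg => //; apply: smooth_xmact => //; apply: smooth_invg.
have m1 k : m (k, 1%g) = 1%g by rewrite /m xmact_1 mulgV.
have m2 l : m (1%g, l) = 1%g by rewrite /m /= invg1 xmact1 mulg1.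
have D := tangent_diag 1%g u w0 sE.
have e2 : tangent (fun g => E (1%g, g)) 1%g u = 0.
  have -> : (fun g => E (1%g, g)) = (fun _ => 0 : 'rV[R]_(mdim G1)).
    apply/funext => g; rewrite /E /=.
    have -> : (fun h => chi 1 * xmact (g * h * g^-1) (chi 1)^-1)%g =
        (fun _ : G0 => 1%g : G1).
      by apply/funext => h; rewrite derivation1 invg1 xmact1 mulg1.
    exact: tangent_cst.
  exact: tangent_cst.
pose B k : 'rV[R]_(mdim G1) := tangent (fun l => m (k, l)) 1%g v.
have sB : smooth B by apply: (smooth_tangent_param (p0 := 1%g) w1 w0 w1 sm v m1).
have e1 : tangent (fun g => E (g, 1%g)) 1%g u = tangent B 1%g (tau u).
  have -> : (fun g => E (g, 1%g)) = (fun g => B (chi g)).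
    apply/funext => g; rewrite /E /B /m /=; congr (tangent _ _ v).
    by apply/funext => h; rewrite mul1g invg1 mulg1.
  exact: (tangent_comp1 u w0 w1 (wr _) sB schi derivation1).
pose L : {linear 'rV[R]_(mdim G1) -> 'rV[R]_(mdim G1)} := -%R.
have sA := smooth_tangent_xmact (tau u).
have e3 := tangent_mixed (p0 := 1%g) w1 w0 w1 sm (tau u) v m1 m2.
(* After the exchange the inner derivative is in [k]: the product and inverse rules give [tau u]
   minus the action of [l] on it. The first term is constant in [l], so only the second one survives
   the outer derivative. *)
have mE : (fun l => tangent (fun k => m (k, l)) 1%g (tau u) : 'rV[R]__) =
    (fun l => tau u + L (tangent (xmact l) 1%g (tau u))).
  apply/funext => l; rewrite /m /=.
  have si : smooth (fun k : G1 => k^-1%g) by exact: lie_inv_smooth.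
  have sai : smooth (fun k : G1 => xmact l k^-1%g).
    exact: (smooth_comp w1 w1 w1 (smooth_xmactr l) si).
  have act1 : xmact l (1^-1)%g = 1%g :> G1 by rewrite invg1 xmact1.
  have f1 := tangent_mulg w1 (tau u) (wc_id w1) sai erefl act1.
  have f2 := tangent_id (1%g : G1) (tau u) w1.
  have f3 := tangent_comp1 (tau u) w1 w1 w1 (smooth_xmactr l) si (invg1 _).
  have f4 := tangent_invg w1 (tau u) (wc_id w1) erefl.
  rewrite f1 f2 f3; congr (_ + _).
  rewrite (etrans f4 (congr1 -%R f2)).
  exact: linearN.
have sLA := smooth_comp w0 (wr _) (wr _) (smooth_linear L) sA.
have e4 := tangent_add 1%g v w0 (smooth_cst (tau u : 'rV[R]__) w0) sLA.
have e5 := tangent_comp 1%g v w0 (wr _) (wr _) (smooth_linear L) sA.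
have e6 : tangent (fun l => tau u + L (tangent (xmact l) 1%g (tau u))) 1%g v =
    - lie_act v (tau u).
  rewrite e4 e5 (tangent_cst (tau u : 'rV[R]__) (1%g : G0) v) add0r.
  exact: tangent_lin.
rewrite mE in e3.
have := congr2 +%R (etrans e1 (etrans e3 e6)) e2.
by rewrite addr0 => e; exact: (etrans D e).
Qed.

End Factors.

(** The bracket is the derivative of [Ad g v] in [g], and the linear map [tangent chi 1] passes
    under that derivative; [tangent chi 1 (Ad g v)] is the derivative in [h] of
    [chi (g * h * g^-1)], to which the factorization applies. *)
Lemma tangent_derivation u v : tangent chi 1%g (lie_bracket u v) =
  lie_bracket (tangent chi 1%g u) (tangent chi 1%g v) +
  lie_act u (tangent chi 1%g v) - lie_act v (tangent chi 1%g u).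
Proof.
rewrite -(tangent_tangent chi 1%g 1%g u w0 (Ad_smooth v)).
pose p g h := (chi g * xmact g (chi h) * (chi g)^-1)%g.
pose q g h := (chi g * xmact (g * h * g^-1) (chi g)^-1)%g.
have p1 (x : G0 * G0) : (chi x.1 * xmact x.2 (chi 1) * (chi x.1)^-1)%g = 1%g.
  by rewrite derivation1 xmact1 mulg1 mulgV.
have q1 (x : G0 * G0) : (chi x.1 * xmact (x.2 * 1 * x.2^-1) (chi x.1)^-1)%g = 1%g.
  by rewrite mulg1 mulgV xmact_1 mulgV.
have sd : smooth (fun g : G0 => (g, g)).
  by apply: smooth_pair => //; exact: wc_id.
have sP : smooth (fun g => tangent (p g) 1%g v : 'rV[R]__).
  exact: (smooth_comp w0 w00 (wr _)
    (smooth_tangent_param w00 w0 w1 smooth_conj_factor v p1) sd).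
have sQ : smooth (fun g => tangent (q g) 1%g v : 'rV[R]__).
  exact: (smooth_comp w0 w00 (wr _)
    (smooth_tangent_param w00 w0 w1 smooth_act_factor v q1) sd).
have -> : (fun g : G0 => tangent chi 1%g (Ad g v)) =
    (fun g => tangent (p g) 1%g v + tangent (q g) 1%g v).
  apply/funext => g.
  have c1 : (g * 1 * g^-1)%g = 1%g by rewrite mulg1 mulgV.
  have f1 := tangent_comp1 v w0 w0 w1 schi
    (smooth_slicer w0 w0 w0 g (conj_smooth G0)) c1.
  have sp : smooth (p g) := smooth_slicer w00 w0 w1 (g, g) smooth_conj_factor.
  have sq : smooth (q g) := smooth_slicer w00 w0 w1 (g, g) smooth_act_factor.
  have f2 := tangent_mulg w0 v sp sq (p1 (g, g)) (q1 (g, g)).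
  rewrite -f2 /Ad -f1; congr (tangent _ _ v); apply/funext => h.
  exact: derivation_conj.
exact: (etrans (tangent_add 1%g u w0 sP sQ)
  (congr2 +%R (tangent_conj_factor u v) (tangent_act_factor u v))).
Qed.

End Derivation.
End CrossedModules.

(** * Maps into embedded submanifolds *)

Section EmbeddingLift.
Context {R : realType}.
Variables (M N : chartedType R).
Hypotheses (wM : well_charted M) (wN : well_charted N).

(** Injectivity is assumed in the preferred chart only; it passes to any chart [c] because the
    differential of the transition map [T] is undone by that of [T']. *)
Lemma diff_inj_chart n (phi : N -> 'rV[R]_n) c q : smooth phi ->
  injective (tangent phi q) -> atlas N c -> cdom c q ->
  injective ('d (phi \o cinv c) (cmap c q)).
Proof.
move=> sphi injphi ac dq v w vw.
pose b := chart_at q; have ab : atlas N b by exact: wc_atlas.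
have db : cdom b q by exact: wc_dom.
have hc := wc_chart wN ac; have hb := wc_chart wN ab.
have [od _ _ _ _] := hc; have [ob _ _ _ _] := hb.
pose T := cmap b \o cinv c; pose T' := cmap c \o cinv b.
have [_ sid] := wc_id wN.
have dT : differentiable T (cmap c q).
  have /smooth_onE/(_ 1)/Ck_diff := sid c b ac ab; apply.
  by exists q.
have TE : T (cmap c q) = cmap b q by rewrite /T /= cmapK.
have dT' : differentiable T' (T (cmap c q)).
  rewrite TE; have /smooth_onE/(_ 1)/Ck_diff := sid b c ab ac; apply.
  by exists q.
have dphi : differentiable (phi \o cinv b) (T (cmap c q)).
  by rewrite TE; apply: (Ck_diff (rV_smooth 1 sphi ab)); exists q.
have near_b := chart_near wN ac dq ob db.
have idn : \forall x \near cmap c q, (T' \o T) x = id x.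
  by apply: filterS near_b => x [r [dr br ->]]; rewrite /T' /T /= !cmapK.
have phin : \forall x \near cmap c q, ((phi \o cinv b) \o T) x = (phi \o cinv c) x.
  by apply: filterS near_b => x [r [dr br ->]]; rewrite /T /= !cmapK.
have [_ idE] := near_eq_diff idn (differentiable_comp dT dT').
have [_ phiE] := near_eq_diff phin (differentiable_comp dT dphi).
have TK z : 'd T' (T (cmap c q)) ('d T (cmap c q) z) = z.
  have e1 := congr1 (@^~ z) (diff_comp dT dT').
  have e2 := congr1 (@^~ z) idE.
  have e3 : 'd id (cmap c q) z = z by rewrite diff_val.
  exact: etrans (esym e1) (etrans (esym e2) e3).
have phiT z : 'd (phi \o cinv c) (cmap c q) z = tangent phi q ('d T (cmap c q) z).
  have e1 := congr1 (@^~ z) (diff_comp dT dphi).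
  have e2 := congr1 (@^~ z) phiE.
  by rewrite /tangent -/b -TE; exact: (etrans e2 e1).
have Tvw := injphi _ _ (etrans (esym (phiT v)) (etrans vw (phiT w))).
exact: etrans (esym (TK v)) (etrans (congr1 _ Tvw) (TK w)).
Qed.

(** That open sets of [N] are preimages under [phi] yields continuity of [f], from which
    [smooth_lift] starts; injectivity of the tangent maps of [phi] then yields the derivatives. *)
Lemma smooth_embedding_lift n (phi : N -> 'rV[R]_n) (f : M -> N) :
  smooth_embedding phi -> smooth (fun x => phi (f x)) -> smooth f.
Proof.
move=> [sphi injphi _ ophi] [cpf spf].
have cf : continuous f.
  apply/continuousP => U /ophi[V oV ->].
  by rewrite -comp_preimage; move/continuousP: cpf; apply.
split=> // c c' ac ac'.
have hc := wc_chart wM ac; have hc' := wc_chart wN ac'.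
have [od _ _ _ _] := hc; have [od' oi' _ _ ci'] := hc'.
have of' : open (f @^-1` cdom c') by apply: open_comp => // x _; exact: cf.
have oU := chart_open_image hc of'.
apply: (smooth_lift (phi := phi \o cinv c') oU oi').
- by move=> _ [p [dp dfp] <-]; exists (f p) => //=; rewrite cmapK.
- move=> _ [p [dp dfp] <-].
  have ci : {for cmap c p, continuous (cinv c)}.
    case: hc => _ oi _ _; rewrite continuous_open_subspace//.
    by apply; rewrite inE; exists p.
  have cc' : {for f (cinv c (cmap c p)), continuous (cmap c')}.
    by rewrite cmapK//; exact: cmap_continuous.
  exact: (continuous_comp (continuous_comp ci (cf _)) cc').
- by apply/smooth_onE => k; exact: rV_smooth.
- by move=> _ [q dq <-]; apply: diff_inj_chart => //; exact: injphi.
- apply/smooth_onE => k.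
  have kpf := rV_smooth k (conj cpf spf) ac.
  have kpfU : Ck k (cmap c @` (cdom c `&` f @^-1` cdom c'))
      ((fun x => phi (f x)) \o cinv c).
    by apply: Ck_sub kpf => _ [p [dp _] <-]; exists p.
  apply: Ck_eq kpfU => // _ [p [dp dfp] <-] /=.
  by rewrite !cmapK.
Qed.

End EmbeddingLift.

(** * Tangent maps as maps of strict Lie 2-algebras *)

Section TangentLfun.
Context {R : realType}.

Lemma bij_lfunK (V W : vectType R) (s : 'Hom(V, W)) : bijective s ->
  cancel s s^-1%VF.
Proof. by move=> /bij_inj/lker0P/lker0_lfunK. Qed.

(** [^-1] is a total operation on linear maps, with its meaning of inverse tied to a trivial kernel;
    this identifies it with a two-sided inverse, as needed for the action of SAut. *)
Lemma lfun_inv_unique (V : vectType R) (a b : 'End(V)) :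
  (b \o a)%VF = \1%VF -> (a \o b)%VF = \1%VF -> (a^-1)%VF = b.
Proof.
move=> ba ab; apply/lfunP => x.
have aK : cancel a b by move=> y; rewrite -comp_lfunE ba id_lfunE.
have /lker0P/lker0_lfunK aK' : injective a by exact: can_inj aK.
by rewrite -[X in (a^-1)%VF X]id_lfunE -ab comp_lfunE aK'.
Qed.

Lemma bij_ex (V W : Type) (s : V -> W) x : bijective s -> exists u, x = s u.
Proof. by case=> s' _ sK; exists (s' x); rewrite sK. Qed.

Lemma tangent_lfunE (G H : lieGroupType R) (V W : vectType R)
    (s : 'Hom(lie G, V)) (t : 'Hom(lie H, W)) (f : G -> H) u : bijective s ->
  tangent_lfun s t f (s u) = t (tangent f 1%g u).
Proof.
move=> sb; rewrite /tangent_lfun !comp_lfunE bij_lfunK//; congr (t _).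
exact: (lfunE ('d (cmap (chart_at (f 1%g)) \o f \o cinv (chart_at 1%g)) _)).
Qed.

Lemma tangent_lfun_comp (G H K : lieGroupType R) (V W X : vectType R)
    (s : 'Hom(lie G, V)) (t : 'Hom(lie H, W)) (r : 'Hom(lie K, X))
    (f : G -> H) (g : H -> K) :
  bijective s -> bijective t -> smooth f -> smooth g -> f 1%g = 1%g ->
  tangent_lfun s r (g \o f) = (tangent_lfun t r g \o tangent_lfun s t f)%VF.
Proof.
move=> sb tb sf sg f1; apply/lfunP => x.
have [u ->] := bij_ex x sb.
rewrite comp_lfunE !tangent_lfunE//; congr (r _).
exact: tangent_comp1 (lie_wc _) (lie_wc _) (lie_wc _) sg sf f1.
Qed.

Lemma tangent_lfun_id (G : lieGroupType R) (V : vectType R)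
    (s : 'Hom(lie G, V)) : bijective s -> tangent_lfun s s id = \1%VF.
Proof.
move=> sb; apply/lfunP => x; have [u ->] := bij_ex x sb.
rewrite tangent_lfunE// id_lfunE; congr (s _).
exact: tangent_id (lie_wc _).
Qed.

Lemma tangent_lfun_cst (G H : lieGroupType R) (V W : vectType R)
    (s : 'Hom(lie G, V)) (t : 'Hom(lie H, W)) (h : H) : bijective s ->
  tangent_lfun s t (fun=> h) = 0.
Proof.
move=> sb; apply/lfunP => x; have [u ->] := bij_ex x sb.
by rewrite tangent_lfunE// tangent_cst linear0 lfunE.
Qed.

Lemma tangent_lfun_mul (G H : lieGroupType R) (V W : vectType R)
    (s : 'Hom(lie G, V)) (t : 'Hom(lie H, W)) (f g : G -> H) : bijective s ->
  smooth f -> smooth g -> f 1%g = 1%g -> g 1%g = 1%g ->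
  tangent_lfun s t (fun x => (f x * g x)%g) =
  tangent_lfun s t f + tangent_lfun s t g.
Proof.
move=> sb sf sg f1 g1; apply/lfunP => x; have [u ->] := bij_ex x sb.
have fE h := tangent_lfunE t h u sb.
have tM := congr1 t (tangent_mulg (lie_wc G) u sf sg f1 g1).
have tfg := etrans tM (linearD t _ _).
have fg := etrans (add_lfunE (tangent_lfun s t f) (tangent_lfun s t g) (s u))
  (congr2 +%R (fE f) (fE g)).
exact: etrans (fE _) (etrans tfg (esym fg)).
Qed.

(** A linear map is the sum over [j] of the rank-one maps [E j w], with [w] its value on the basis
    vector of index [j]. As [E j w] is linear in [w], the claim reduces to smoothness of tangent
    vectors in a fixed direction, that is to [smooth_tangent_param]. *)
Lemma smooth_tangent_lfun (M : chartedType R) (G H : lieGroupType R)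
    (V W : vectType R) (s : 'Hom(lie G, V)) (t : 'Hom(lie H, W))
    (ev : M -> G -> H) n (L : 'Hom(V, W) -> 'rV[R]_n) : well_charted M ->
  linear L -> smooth (fun p : M * G => ev p.1 p.2) -> (forall x, ev x 1%g = 1%g) ->
  smooth (fun x => L (tangent_lfun s t (ev x))).
Proof.
move=> wM hL sev ev1.
have linE j (w : 'rV[R]_(mdim H)) :
    linear (fun u : 'rV[R]_(mdim G) => u 0 j *: w).
  by move=> a u v; rewrite !mxE scalerDl scalerA.
pose E j (w : 'rV[R]_(mdim H)) :=
  (t \o linfun (fun u : 'rV[R]_(mdim G) => u 0 j *: w) \o s^-1)%VF.
have EE j w x : E j w x = (s^-1%VF x) 0 j *: t w.
  by rewrite !comp_lfunE (lfunE (linear_pack (linE j w))) /= linearZ.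
have linLE j : linear (fun w => L (E j w)).
  move=> a w w'; rewrite -hL; congr (L _); apply/lfunP => x.
  by rewrite add_lfunE scale_lfunE !EE linearP scalerDr !scalerA [a * _]mulrC.
pose F j : {linear 'rV[R]_(mdim H) -> 'rV[R]_n} := linear_pack (linLE j).
pose Llin : {linear 'Hom(V, W) -> 'rV[R]_n} :=
  HB.pack L (GRing.isLinear.Build _ _ _ _ L hL).
have -> : (fun x => L (tangent_lfun s t (ev x))) =
    (fun x => \sum_j F j (tangent (ev x) 1%g (delta_mx 0 j))).
  apply/funext => x.
  rewrite -(linear_sum Llin _ _ (fun j => E j (tangent (ev x) 1%g (delta_mx 0 j)))).
  congr (L _); apply/lfunP => v; rewrite sum_lfunE /tangent_lfun !comp_lfunE.
  under eq_bigr do rewrite EE -linearZ.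
  rewrite -linear_sum; congr (t _).
  set D := 'd (cmap (chart_at (ev x 1%g)) \o ev x \o cinv (chart_at 1%g))
              (cmap (chart_at 1%g) 1%g).
  rewrite (lfunE D); exact: linear_rV_sum.
apply: smooth_rV_sum => // j.
apply: (smooth_comp wM (rV_well_charted _) (rV_well_charted _)
  (smooth_linear (F j))).
exact: (smooth_tangent_param wM (lie_wc G) (lie_wc H) sev _ ev1).
Qed.

End TangentLfun.

(** * Tangent maps of automorphisms and derivations lie in SAut(g) *)

Section Differentiation.
Variables (R : realType) (g : strictLie2Alg R) (G : lieXMod R).
Variables (t0 : 'Hom(lie (xm0 G), lg0 g)) (t1 : 'Hom(lie (xm1 G), lg1 g)).
Hypothesis hG : differentiates_to t0 t1.
Notation G0 := (xm0 G).
Notation G1 := (xm1 G).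
Let b0 := diff_iso0 hG.
Let b1 := diff_iso1 hG.
Let w0 := lie_wc G0.
Let w1 := lie_wc G1.
Let sd : smooth (@xmd _ G) := (@xmd_hom _ G).1.
Let d1 : @xmd _ G 1%g = 1%g := lie_hom1 (@xmd_hom _ G).2.

Lemma tangent_lfun_xmd : tangent_lfun t1 t0 (@xmd _ G) = ld g.
Proof.
apply/lfunP => a; have [u ->] := bij_ex a b1.
exact: (etrans (tangent_lfunE t0 _ u b1) (diff_d hG u)).
Qed.

Lemma lie_aut_bij (H : lieGroupType R) (V : vectType R) (t : 'Hom(lie H, V))
    (f : H -> H) : bijective t -> is_lie_aut f -> bijective (tangent_lfun t t f).
Proof.
move=> tb [[sf fM] [f' [fK f'K sf']]].
have f1 := lie_hom1 fM.
have f'1 : f' 1%g = 1%g by rewrite -[X in f' X]f1 fK.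
have e1 := tangent_lfun_comp t tb tb sf sf' f1.
have e2 := tangent_lfun_comp t tb tb sf' sf f'1.
have ff' : f' \o f = id by apply/funext.
have f'f : f \o f' = id by apply/funext.
rewrite ff' tangent_lfun_id// in e1; rewrite f'f tangent_lfun_id// in e2.
exists (tangent_lfun t t f') => x.
  by rewrite -comp_lfunE -e1 id_lfunE.
by rewrite -comp_lfunE -e2 id_lfunE.
Qed.

Lemma Aut0_SAut0 F : Aut0 F ->
  SAut0 (tangent_lfun t0 t0 F.1, tangent_lfun t1 t1 F.2).
Proof.
move=> [a0 a1 Fd Fact]; have [[s0 F0M] _] := a0; have [[s1 F1M] _] := a1.
have F01 := lie_hom1 F0M; have F11 := lie_hom1 F1M.
split=> /=.
- by split; exact: lie_aut_bij.
- have e1 := tangent_lfun_comp t0 b1 b0 sd s0 d1.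
  have e2 := tangent_lfun_comp t0 b1 b1 s1 sd F11.
  have e : F.1 \o @xmd _ G = @xmd _ G \o F.2 by apply/funext => h; exact: Fd.
  rewrite -tangent_lfun_xmd.
  exact: etrans (esym e1) (etrans (congr1 (tangent_lfun t1 t0) e) e2).
- move=> x y; have [u ->] := bij_ex x b0; have [v ->] := bij_ex y b0.
  rewrite -(diff_br0 hG) !(tangent_lfunE t0 _ _ b0) (tangent_bracket u v s0 F0M).
  exact: diff_br0 hG _ _.
- move=> x a; have [u ->] := bij_ex x b0; have [b ->] := bij_ex a b1.
  rewrite -(diff_act hG) (tangent_lfunE t0 _ _ b0) !(tangent_lfunE t1 _ _ b1).
  rewrite -(diff_act hG); congr (t1 _).
  exact: tangent_lie_act.
Qed.

(** The product is pointwise [chi] after [xmd (chi' a) * a], times [chi']; its tangent map is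
    [tau (d tau' + 1) + tau'], which is [star]. *)
Lemma tangent_lfun_der_mul chi chi' : is_derivation chi -> is_derivation chi' ->
  tangent_lfun t0 t1 (der_mul chi chi') =
  star (tangent_lfun t0 t1 chi) (tangent_lfun t0 t1 chi').
Proof.
move=> [sc cM] [sc' c'M].
have c1 := derivation1 cM; have c'1 := derivation1 c'M.
have sdc : smooth (@xmd _ G \o chi') := smooth_comp w0 w1 w0 sd sc'.
have dc1 : (@xmd _ G \o chi') 1%g = 1%g by rewrite /= c'1.
have m1 : (xmd (chi' 1) * 1 = 1 :> G0)%g by rewrite c'1 d1 mulg1.
have sm : smooth (fun a : G0 => xmd (chi' a) * a)%g.
  by apply: smooth_mulg => //; exact: wc_id.
have scm : smooth (chi \o (fun a : G0 => xmd (chi' a) * a)%g).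
  exact: smooth_comp w0 w0 w1 sc sm.
have cm1 : (chi \o (fun a : G0 => xmd (chi' a) * a)%g) 1%g = 1%g.
  by rewrite /= m1.
have e1 := tangent_lfun_mul t1 b0 scm sc' cm1 c'1.
have e2 := tangent_lfun_comp t1 b0 b0 sm sc m1.
have e3 := tangent_lfun_mul t0 b0 sdc (wc_id w0) dc1 erefl.
have e4 := tangent_lfun_comp t0 b0 b1 sc' sd c'1.
have e5 := tangent_lfun_id b0.
rewrite /star -[LHS]/(tangent_lfun t0 t1 (fun x =>
  (chi \o (fun a : G0 => xmd (chi' a) * a)%g) x * chi' x)%g) e1 e2.
rewrite e3 e4 e5 tangent_lfun_xmd comp_lfunDr comp_lfun1r comp_lfunA.
move: (tangent_lfun t0 t1 chi) (tangent_lfun t0 t1 chi') => a b.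
by rewrite -addrA [LHS]addrC.
Qed.

Lemma Aut1_SAut1 chi : Aut1 chi -> SAut1 (tangent_lfun t0 t1 chi).
Proof.
move=> [dc [chi' [dc' cc' c'c]]]; split.
  exists (tangent_lfun t0 t1 chi').
  (* The unit [der_one] is a constant map, so its tangent map is 0, the unit of [star]. *)
  have cst0 := tangent_lfun_cst t1 (1%g : G1) b0.
  have e := tangent_lfun_der_mul dc dc'; rewrite cc' in e.
  have e' := tangent_lfun_der_mul dc' dc; rewrite c'c in e'.
  by split; [exact: etrans (esym e) cst0|exact: etrans (esym e') cst0].
case: dc => sc cM x y; have [u ->] := bij_ex x b0; have [v ->] := bij_ex y b0.
have fE w := tangent_lfunE t1 chi w b0.
have brE := congr1 (tangent_lfun t0 t1 chi) (diff_br0 hG u v).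
have actE z w : t1 (lie_act z w) = lact (t0 z) (t1 w) := diff_act hG z w.
have br1 := diff_br1 hG (tangent chi 1%g u) (tangent chi 1%g v).
(* The bracket of degree -1 differentiates to [[d (tau u), tau v]], while [SAut1] has
   [[tau u, d (tau v)]]; the Peiffer identity exchanges them. *)
rewrite ld_peiffer in br1.
have chiE := etrans (congr1 t1 (tangent_derivation sc cM u v))
  (etrans (linearB t1 _ _) (congr2 (fun x y => x - y)
    (etrans (linearD t1 _ _) (congr2 +%R br1 (actE _ _))) (actE _ _))).
rewrite (fE u) (fE v); apply: (etrans (esym brE) (etrans (fE _) (etrans chiE _))).
move: (t1 (tangent chi 1%g u)) (t1 (tangent chi 1%g v)) => a b.
by rewrite -addrA addrC.
Qed.

End Differentiation.

Section V2r.
Import VectorInternalTheory.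

Lemma v2r_linear (R : realType) (V : vectType R) : linear (v2r : V -> 'rV_ _).
Proof. exact: linearP. Qed.

End V2r.

(** * The homomorphism of crossed modules *)

Theorem theorem6p5 (R : realType) (g : strictLie2Alg R) (G : lieXMod R)
    (t0 : 'Hom(lie (xm0 G), lg0 g))
    (t1 : 'Hom(lie (xm1 G), lg1 g))
    (hG : differentiates_to t0 t1)
    (A : lieXMod R)
    (i0 : xm0 A -> (xm0 G -> xm0 G) * (xm1 G -> xm1 G))
    (i1 : xm1 A -> xm0 G -> xm1 G)
    (hA : is_Aut i0 i1)
    (S : lieXMod R)
    (j0 : xm0 S -> 'End(lg0 g) * 'End(lg1 g))
    (j1 : xm1 S -> 'Hom(lg0 g, lg1 g))
    (hS : is_SAut j0 j1) :
  exists (f1 : xm1 A -> xm1 S) (f0 : xm0 A -> xm0 S),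
    [/\ is_lieXMod_hom f1 f0,
        forall F : xm0 A, j0 (f0 F) =
          (tangent_lfun t0 t0 (i0 F).1, tangent_lfun t1 t1 (i0 F).2)
      & forall chi : xm1 A, j1 (f1 chi) = tangent_lfun t0 t1 (i1 chi)].
Proof.
have [A0fun _ _] := Aut0_bij hA; have [A1fun _ _] := Aut1_bij hA.
have [_ S0inj S0surj] := SAut0_bij hS; have [_ S1inj S1surj] := SAut1_bij hS.
have {}S0inj s s' : j0 s = j0 s' -> s = s' by apply: S0inj; rewrite inE.
have {}S1inj s s' : j1 s = j1 s' -> s = s' by apply: S1inj; rewrite inE.
have A0F F : Aut0 (i0 F) by exact: A0fun.
have A1c c : Aut1 (i1 c) by exact: A1fun.
have b0 := diff_iso0 hG; have b1 := diff_iso1 hG.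
pose T0 f := tangent_lfun t0 t0 f; pose T1 f := tangent_lfun t1 t1 f.
pose T f := tangent_lfun t0 t1 f.
(* The tangent data lie in [SAut0] and [SAut1], the images of [j0] and [j1], so preimages can be
   chosen; injectivity of [j0] and [j1] makes them unique and reduces every algebraic identity to
   one between tangent maps. *)
have /boolp.choice[f0 f0E] : forall F, exists s, j0 s = (T0 (i0 F).1, T1 (i0 F).2).
  by move=> F; have [s _ sE] := S0surj _ (Aut0_SAut0 hG (A0F F)); exists s.
have /boolp.choice[f1 f1E] : forall c, exists s, j1 s = T (i1 c).
  by move=> c; have [s _ sE] := S1surj _ (Aut1_SAut1 hG (A1c c)); exists s.
exists f1, f0; split=> //.
have sF1 F : smooth (i0 F).1 by have [[[]]] := A0F F.
have sF2 F : smooth (i0 F).2 by have [_ [[]]] := A0F F.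
have F11 F : (i0 F).1 1%g = 1%g by have [[[_ /lie_hom1]]] := A0F F.
have F21 F : (i0 F).2 1%g = 1%g by have [_ [[_ /lie_hom1]]] := A0F F.
have sc c : smooth (i1 c) by have [[]] := A1c c.
have c1 c : i1 c 1%g = 1%g by have [[_ /derivation1]] := A1c c.
have sd : smooth (@xmd _ G) := (@xmd_hom _ G).1.
have d1 : @xmd _ G 1%g = 1%g := lie_hom1 (@xmd_hom _ G).2.
have w0 := lie_wc (xm0 G); have w1 := lie_wc (xm1 G).
have wA0 := lie_wc (xm0 A); have wA1 := lie_wc (xm1 A).
have T0M F F' : T0 ((i0 F).1 \o (i0 F').1) = (T0 (i0 F).1 \o T0 (i0 F').1)%VF.
  by apply: tangent_lfun_comp.
have T1M F F' : T1 ((i0 F).2 \o (i0 F').2) = (T1 (i0 F).2 \o T1 (i0 F').2)%VF.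
  by apply: tangent_lfun_comp.
(* Multiplicativity of [i0] makes the automorphism read from 1 idempotent; being injective, it is
   the identity. *)
have i01 : (i0 1%g).1 = id.
  have e := congr1 fst (Aut0_mul hA 1%g 1%g); rewrite mulg1 /= in e.
  have [[_ [f' [fK _ _]]] _ _ _] := A0F 1%g.
  by apply/funext => x; apply: (can_inj fK); rewrite [in RHS]e.
split.
- split; last first.
    move=> c c'; apply: S1inj.
    rewrite (SAut1_mul hS) !f1E (Aut1_mul hA).
    refine (tangent_lfun_der_mul hG (A1c c).1 (A1c c').1).
  apply: (smooth_embedding_lift wA1 (lie_wc _) (SAut1_embedding hS)).
  have -> : (fun x => VectorInternalTheory.v2r (j1 (f1 x))) =
      (fun c => VectorInternalTheory.v2r (T (i1 c))).
    by apply/funext => c; rewrite f1E.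
  have hL : linear (VectorInternalTheory.v2r : 'Hom(lg0 g, lg1 g) -> _).
    exact: v2r_linear.
  refine (smooth_tangent_lfun t0 t1 wA1 hL (Aut_ev1 hA) c1).
- split; last first.
    move=> F F'; apply: S0inj.
    by rewrite (SAut0_mul hS) !f0E (Aut0_mul hA) T0M T1M.
  apply: (smooth_embedding_lift wA0 (lie_wc _) (SAut0_embedding hS)).
  (* [smooth_tangent_lfun] treats one linear map at a time; the coordinates of a pair are the sum of
     linear images of its two components. *)
  pose L0 a : 'rV[R]_ _ :=
    VectorInternalTheory.v2r (a : 'End(lg0 g), 0 : 'End(lg1 g)).
  pose L1 a : 'rV[R]_ _ :=
    VectorInternalTheory.v2r (0 : 'End(lg0 g), a : 'End(lg1 g)).
  have L0l : linear L0.
    move=> x a a'; rewrite /L0 -v2r_linear; congr VectorInternalTheory.v2r.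
    by congr pair => /=; rewrite scaler0 addr0.
  have L1l : linear L1.
    move=> x a a'; rewrite /L1 -v2r_linear; congr VectorInternalTheory.v2r.
    by congr pair => /=; rewrite scaler0 addr0.
  have -> : (fun x => VectorInternalTheory.v2r (j0 (f0 x))) =
      (fun F => L0 (T0 (i0 F).1) + L1 (T1 (i0 F).2)).
    apply/funext => F; rewrite f0E /L0 /L1 -[X in X + _]scale1r -v2r_linear.
    rewrite scale1r; congr VectorInternalTheory.v2r.
    by congr pair => /=; rewrite ?addr0 ?add0r.
  apply: smooth_rV_add => //.
    refine (smooth_tangent_lfun t0 t0 wA0 L0l (Aut_ev00 hA) F11).
  refine (smooth_tangent_lfun t1 t1 wA0 L1l (Aut_ev01 hA) F21).
- move=> c; apply: S0inj.
  rewrite (SAut_d hS) f0E f1E (Aut_d hA) /=.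
  have sdc : smooth (@xmd _ G \o i1 c) := smooth_comp w0 w1 w0 sd (sc c).
  have scd : smooth (i1 c \o @xmd _ G) := smooth_comp w1 w0 w1 (sc c) sd.
  have dc1 : (@xmd _ G \o i1 c) 1%g = 1%g by rewrite /= c1.
  have cd1 : (i1 c \o @xmd _ G) 1%g = 1%g by rewrite /= d1.
  have e0 := tangent_lfun_mul t0 b0 sdc (wc_id (lie_wc _)) dc1 erefl.
  have e1 := tangent_lfun_mul t1 b1 scd (wc_id (lie_wc _)) cd1 erefl.
  have e0' := tangent_lfun_comp t0 b0 b1 (sc c) sd (c1 c).
  have e1' := tangent_lfun_comp t1 b1 b0 sd (sc c) d1.
  rewrite tangent_lfun_xmd// in e0' e1'.
  rewrite e0' tangent_lfun_id// addrC in e0.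
  rewrite e1' tangent_lfun_id// addrC in e1.
  by congr pair; rewrite ?e0 ?e1.
- move=> F c; apply: S1inj.
  rewrite (SAut_act hS) !f1E f0E (Aut_act hA) /=.
  (* Functoriality of the tangent map: those of [F] and of its inverse in the group compose to the
     identity in both orders. *)
  have FV : (T0 (i0 F).1)^-1%VF = T0 (i0 F^-1%g).1.
    apply: lfun_inv_unique.
      have e := congr1 fst (Aut0_mul hA F^-1%g F).
      by rewrite mulVg i01 /= in e; rewrite -T0M -e; apply: tangent_lfun_id.
    have e := congr1 fst (Aut0_mul hA F F^-1%g).
    by rewrite mulgV i01 /= in e; rewrite -T0M -e; apply: tangent_lfun_id.
  rewrite FV.
  have s2 : smooth ((i0 F).2 \o i1 c) := smooth_comp w0 w1 w1 (sF2 F) (sc c).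
  have e1 := tangent_lfun_comp t1 b0 b0 (sF1 F^-1%g) s2 (F11 _).
  have e2 := tangent_lfun_comp t1 b0 b1 (sc c) (sF2 F) (c1 c).
  by rewrite /T e1 e2.
Qed.
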